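(* For every integer $k\ge 1$, the cumulative rank distribution $\bar r_k$ of the infinite random recursive tree is given by $$\bar r_k=\int_{0<\alpha_1<\dots<\alpha_k<1}\alpha_1\, f_k(1-\alpha_k)\prod_{i=1}^{k-1}\left[1+f_i(1-\alpha_i)\right]\,d\alpha_1\cdots d\alpha_k,$$ with the convention $\prod_{i=1}^{k-1}=1$ when $k=1$, where the functions $f_i:[0,1)\to\mathbb R$ are defined recursively by $$f_0(x)=\frac{1}{1-x},\qquad f_i(x)=\exp\left[\int_0^x f_{i-1}(x')\,dx'\right]-1\quad\text{for all } i\ge 1.$$
   Context: A random recursive tree (RRT) $G_n$ of size $n$ is a random labeled tree on the node set $\{1,\dots,n\}$ built as follows: start with node $1$; for $t=2,\dots,n$, node $t$ is attached by an edge to one node chosen uniformly at random from the existing nodes $\{1,\dots,t-1\}$, independently of previous choices. A leaf is a node of degree $1$ (the root, node $1$, is also a leaf if it has degree $1$). The rank of a node is its graph distance to the closest leaf, so leaves have rank $0$; in the one-node tree ($n=1$) the single node has rank $0$. Let $R_{n,k}$ be the number of nodes of rank $k$ in $G_n$, let $r_k(n)=\mathbb E[R_{n,k}/n]$, and let $r_k=\lim_{n\to\infty}r_k(n)$ (these limits exist). The cumulative rank distribution of the infinite RRT is $\bar r_k=\sum_{k'=k}^\infty r_{k'}$. *)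

(* Defs.v *)
From HB Require Import structures.
From mathcomp Require Export all_boot all_order all_algebra.
From mathcomp Require Export all_classical all_reals all_analysis.

#[export] Set Implicit Arguments.
#[export] Unset Strict Implicit.
#[export] Unset Printing Implicit Defensive.

Import Order.TTheory GRing.Theory Num.Theory.
Import numFieldNormedType.Exports.

Local Open Scope classical_set_scope.
Local Open Scope ring_scope.

Section Graph.
Local Open Scope nat_scope.
Variables (T : finType) (e : rel T).

Definition degree (x : T) : nat := #|[pred y | e x y]|.

Definition leaf (x : T) : bool := degree x == 1.

Definition walk (d : nat) (x y : T) : bool :=
  [exists p : d.-tuple T, path e x p && (last x p == y)].

(* A shortest walk has fewer than #|T| edges, so the value #|T| plays the role
   of infinity: it is returned exactly when y is not reachable from x. *)
Definition gdist (x y : T) : nat := find (fun d => walk d x y) (iota 0 #|T|).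

(* A tree with at least two nodes has a leaf, so the default value #|T| of the
   minimum never matters there; the one-node tree has no node of degree 1 and
   its node is given rank 0 by convention. *)
Definition rank (x : T) : nat :=
  if #|T| == 1 then 0 else \big[minn/#|T|]_(y | leaf y) gdist x y.

End Graph.

(* The node labelled i.+1 is i : 'I_n; the root is thus the ordinal 0. The
   choice w t : 'I_t.+1 is the node to which the ordinal t.+1 is attached: it
   ranges over the t.+1 nodes that precede it. *)
Definition rrt_choice (n : nat) : finType := {dffun forall t : 'I_n.-1, 'I_t.+1}.

Definition rrt_edge (n : nat) (w : rrt_choice n) : rel 'I_n := fun u v =>
  [exists t : 'I_n.-1,
    ((u == t.+1 :> nat) && (v == w t :> nat)) ||
    ((v == t.+1 :> nat) && (u == w t :> nat))].

Section RandomRecursiveTree.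
Variable R : realType.

(* The choices are independent, that of t being uniform on 'I_t.+1. *)
Definition rrt_prob (n : nat) (w : rrt_choice n) : R :=
  \prod_(t < n.-1) (t.+1)%:R^-1.

Definition rrt_expect (n : nat) (X : rrt_choice n -> R) : R :=
  \sum_(w : rrt_choice n) rrt_prob w * X w.

Definition rank_count (n k : nat) (w : rrt_choice n) : nat :=
  #|[pred v : 'I_n | rank (rrt_edge w) v == k]|.

Definition rank_freq (k n : nat) : R :=
  rrt_expect (fun w : rrt_choice n => (rank_count k w)%:R / n%:R).

Definition rank_lim (k : nat) : R := limn (rank_freq k).

Definition cum_rank (k : nat) : \bar R :=
  (\sum_(k <= j <oo) (rank_lim j)%:E)%E.

(* Only meant for x in [0, 1[. *)
Fixpoint rrt_f (i : nat) (x : R) : R :=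
  match i with
  | 0 => (1 - x)^-1
  | j.+1 => expR (\int[lebesgue_measure]_(y in `[0, x]) rrt_f j y) - 1
  end.

End RandomRecursiveTree.

Section LebesgueTuple.
Variables (R : realType) (n : nat).
Notation Rn := (n.-tuple (measurableTypeR R)).
Notation Rn1 := (n.+1.-tuple (measurableTypeR R)).

Definition cons_pair (p : measurableTypeR R * Rn) : Rn1 := [tuple of p.1 :: p.2].

Lemma measurable_cons_pair : measurable_fun [set: measurableTypeR R * Rn] cons_pair.
Proof. exact: measurable_cons. Qed.

Variable mu : {sigma_finite_measure set Rn -> \bar R}.

Definition lebesgue_cons : set Rn1 -> \bar R :=
  pushforward (lebesgue_measure \x mu)%E cons_pair.

Let lebesgue_cons0 : lebesgue_cons set0 = 0%E.
Proof. by rewrite /lebesgue_cons /pushforward preimage_set0 measure0. Qed.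

Let lebesgue_cons_ge0 A : (0 <= lebesgue_cons A)%E.
Proof. by rewrite /lebesgue_cons /pushforward; exact: measure_ge0. Qed.

Let lebesgue_cons_sigma_additive : semi_sigma_additive lebesgue_cons.
Proof.
have mc := measurable_cons_pair.
exact: (@measure_semi_sigma_additive _ _ _
  (pushforward (lebesgue_measure \x mu)%E cons_pair : {measure set _ -> \bar R})).
Qed.

HB.instance Definition _ := isMeasure.Build _ _ _ lebesgue_cons
  lebesgue_cons0 lebesgue_cons_ge0 lebesgue_cons_sigma_additive.

Let lebesgue_cons_sigma_finite : sigma_finite setT lebesgue_cons.
Proof.
have /sigma_finiteP[F [TF ndF mF]] := sigma_finiteT (@lebesgue_measure R).
have /sigma_finiteP[G [TG ndG mG]] := sigma_finiteT mu.
pose g (t : Rn1) : measurableTypeR R * Rn := (tnth t ord0, [tuple of behead t]).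
have mg : measurable_fun setT g.
  apply: measurable_fun_pair; first exact: measurable_tnth.
  exact: measurable_behead.
have gK : cancel cons_pair g.
  by case=> x t; rewrite /g /= (tnth_nth x) /=; congr pair; exact/val_inj.
exists (fun i => g @^-1` (F i `*` G i)).
  rewrite predeqE => t; split=> // _.
  have [i _ Fi] : (\bigcup_i F i) (g t).1 by rewrite -TF.
  have [j _ Gj] : (\bigcup_i G i) (g t).2 by rewrite -TG.
  exists (maxn i j) => //; split.
  - by move: Fi; exact/subsetPset/ndF/leq_maxl.
  - by move: Gj; exact/subsetPset/ndG/leq_maxr.
move=> i; have [mFi Fioo] := mF i; have [mGi Gioo] := mG i; split.
  by rewrite -[X in measurable X]setTI; apply: mg => //; exact: measurableX.
rewrite /lebesgue_cons /pushforward (_ : _ @^-1` _ = F i `*` G i).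
  by rewrite product_measure1E// lte_mul_pinfty// ge0_fin_numE.
by rewrite -comp_preimage (_ : _ \o _ = id)//; apply/funext => p; exact: gK.
Qed.

HB.instance Definition _ := Measure_isSigmaFinite.Build _ _ _ lebesgue_cons
  lebesgue_cons_sigma_finite.

End LebesgueTuple.

(* Lebesgue measure on R^k, as the k-fold product of the one on R. *)
Fixpoint lebesgue_tuple (R : realType) (k : nat) :
    {sigma_finite_measure set (k.-tuple (measurableTypeR R)) -> \bar R} :=
  match k with
  | 0 => dirac [tuple]
  | j.+1 => lebesgue_cons (lebesgue_tuple R j)
  end.

(* 0 < alpha_1 < ... < alpha_k < 1 *)
Definition open_simplex (R : realType) (k : nat) :
    set (k.-tuple (measurableTypeR R)) :=
  [set a | path (fun x y : R => x < y) 0 (rcons a 1)].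

(* Main.v *)
Require Import Defs.
From mathcomp Require Import zify ring lra measurable_realfun.
Import Order.TTheory GRing.Theory Num.Theory.
Import numFieldNormedType.Exports.
Local Open Scope classical_set_scope.
Local Open Scope ring_scope.

(** Fix [k] and call a node of a large random recursive tree good if its rank is
    at least [k]. Away from the root, the rank of a node is the minimum of its
    distance to the childless nodes below it and of one plus the rank of its
    parent. So a node is good exactly when, for each [i] in [1, k], its ancestor at
    distance [k - i] has all its childless descendants at distance at least [i]
    ([high_rankE], [leaf_free_nonroot]), unless the root is among these ancestors;
    that concerns only the nodes of depth below [k], which are negligible
    ([mean_depth_weight_cvg]). Goodness is thus read off the fringe subtree of the
    ancestor at distance [k - 1].

    The tree obeys a splitting property ([rrt_mean_split]): the subtree of the
    second node has uniform size, and it and the remaining tree are independent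
    random recursive trees. It implies that fringe subtrees with [m] nodes have
    asymptotic frequency [1 / (m (m + 1))] and are then random recursive trees
    ([rrt_mean_fringe]). Let [c_m] be the mean number of nodes of depth [k - 1] in
    a random recursive tree with [m] nodes, such that for each [i] in [1, k] all
    the childless descendants of the node at depth [i - 1] on the path from the
    root to it are at distance at least [i] from that node. The limiting
    cumulative distribution is the sum of [c_m / (m (m + 1))] ([cum_rankE]).
    Convergence of the cumulative sums needs that no mass escapes to infinite
    rank: a node of rank at least [k] has [k] descendants, which bounds the tail
    by [1 / (k + 1)] ([path_mean_sum_le]).

    It remains to sum the series. Since [1 / (m (m + 1))] is the integral of
    [x (1 - x) ^ (m - 1)] over the unit interval, the sum is the integral of
    [x U_1 (1 - x)] for the generating function [U_1] of the [c_m]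
    ([integral_path_gf]). Conditions on all the children of a root factor through
    the splitting property, which becomes a linear differential equation for
    generating functions. With [f_i] generating the probabilities that all
    childless nodes are at depth at least [i], it gives
    [1 + f_{i+1} = exp (int f_i)], the recursion of the statement ([kids_gfE],
    [rrt_fE]). For trees with a marked path whose root has level [i] it gives
    [U_i = (1 + f_i) int U_{i+1}] for [i < k] and [U_k = f_k] ([path_gfE]).
    Unfolding this recursion and reflecting the variables by [x = 1 - alpha] is
    the integral over the simplex, one coordinate at a time
    ([integral_path_density]). *)

(** * Unlabelled recursive trees and the path statistics *)

(** A rooted tree whose children are ordered by age, cut at the oldest child of
    its root: in [Graft a b], [a] is the subtree of that child and [b] is what
    remains. Nodes thus correspond to occurrences of [Single], and attaching a
    new youngest child to a node replaces its [Single] by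
    [Graft Single Single]. *)
Inductive rtree := Single | Graft of rtree & rtree.

Fixpoint grow (T : rtree) : seq rtree :=
  match T with
  | Single => [:: Graft Single Single]
  | Graft a b => [seq Graft a' b | a' <- grow a] ++ [seq Graft a b' | b' <- grow b]
  end.

(** Every history of attachments of [n] nodes occurs once, so that the uniform
    law on this list, with multiplicities, is that of the random recursive tree
    with [n.+1] nodes. *)
Fixpoint grown (n : nat) : seq rtree :=
  if n is m.+1 then flatten [seq grow T | T <- grown m] else [:: Single].

Fixpoint edges (T : rtree) : nat :=
  if T is Graft a b then (edges a + edges b).+1 else 0.

Definition single (T : rtree) : bool := if T is Single then true else false.

(** The condition on [a] is [deep i a], inlined to make the recursion
    structural. *)
Fixpoint kids_deep (i : nat) (T : rtree) {struct T} : bool :=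
  if T is Graft a b then
    (if i is i'.+1 then ~~ single a && kids_deep i' a else true) && kids_deep i b
  else true.

(** All childless nodes are at depth at least [i]. *)
Definition deep (i : nat) (T : rtree) : bool :=
  if i is i'.+1 then ~~ single T && kids_deep i' T else true.

(** The number of nodes at depth [j] such that the node at depth [d] on the path
    from the root to it is [deep (i + d)], for [0 < d <= j]. *)
Fixpoint deep_below (j i : nat) (T : rtree) {struct T} : nat :=
  if j is j'.+1 then
    if T is Graft a b then (deep i.+1 a * deep_below j' i.+1 a + deep_below j i b)%N
    else 0%N
  else 1%N.

Definition deep_path (j i : nat) (T : rtree) : nat := (deep i T * deep_below j i T)%N.

(** The number of nodes of rank at least [k] outside the root, if [h i] tells
    whether the root has rank at least [i]. Away from the root, a node has rank at
    least [i] exactly when it is [deep i] and its parent has rank at least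
    [i.-1]; the parent of the root of [a] is the root of the whole tree. *)
Fixpoint high_rank (k : nat) (h : nat -> bool) (T : rtree) : nat :=
  if T is Graft a b then
    let ha i := deep i a && h i.-1 in
    (ha k + high_rank k ha a + high_rank k h b)%N
  else 0.

(** The sum of [phi] over the fringe subtrees of the nodes other than the
    root. *)
Fixpoint fringe_sum (V : nmodType) (phi : rtree -> V) (T : rtree) : V :=
  if T is Graft a b then phi a + fringe_sum phi a + fringe_sum phi b else 0.

Lemma kids_deepG i a b : kids_deep i (Graft a b) = deep i a && kids_deep i b.
Proof. by []. Qed.

Lemma deepG i a b : deep i.+1 (Graft a b) = deep i a && kids_deep i b.
Proof. by []. Qed.

Lemma deepSE i T : deep i.+1 T = ~~ single T && kids_deep i T.
Proof. by []. Qed.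

Arguments deep : simpl never.
Arguments kids_deep : simpl never.

Lemma kids_deep_anti i T : kids_deep i.+1 T -> kids_deep i T.
Proof.
elim: T i => [|a IHa b IHb] // i; rewrite !kids_deepG => /andP[da /IHb->].
by case: i da => // i; rewrite !deepSE => /andP[-> /IHa ->].
Qed.

Lemma deepS i T : deep i.+1 T -> deep i T.
Proof. by case: i => // i; rewrite !deepSE => /andP[-> /kids_deep_anti]. Qed.

Lemma deep_leq i j T : (i <= j)%N -> deep j T -> deep i T.
Proof. by move=> /subnK <-; elim: (j - i)%N => // m IH; rewrite addSn => /deepS. Qed.

Lemma deep_edges i T : deep i T -> (i <= edges T)%N.
Proof.
elim: T i => [|a IHa b _] [|i] //; rewrite deepG => /andP[/IHa] /=; lia.
Qed.

Lemma deep_below0 i T : deep_below 0 i T = 1%N.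
Proof. by case: T. Qed.

(** The marked path enters the first subtree or avoids it. The factor
    [deep i a] that the root requires from the first subtree is implied by
    [deep i.+2 a] in the first case. *)
Lemma deep_pathG j i a b :
  deep_path j.+1 i.+1 (Graft a b) =
  (deep_path j i.+2 a * kids_deep i b + deep i a * deep_path j.+1 i.+1 b)%N.
Proof.
rewrite /deep_path deepG /=.
have -> : (deep i.+1 b * deep_below j.+1 i.+1 b =
           kids_deep i b * deep_below j.+1 i.+1 b)%N by case: b => //=; lia.
have := @deep_leq i i.+2 a (leq_trans (leqnSn _) (leqnSn _)).
case: (deep i.+2 a) => [->|_] //=; case: (kids_deep i b); lia.
Qed.

(** A node has rank at least [k.+1] when its ancestor at distance [d] is
    [deep (k.+1 - d)] for every [d <= k]. If none of these ancestors is the root,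
    the node is counted by [deep_path k 1] in the fringe subtree of its ancestor
    at distance [k]; otherwise the root is an ancestor at distance
    [k.+1 - i] for some [i] in [1, k], and contributes [h i]. *)
Lemma high_rankE k (h : nat -> bool) T : h 0%N ->
  high_rank k.+1 h T =
  (\sum_(1 <= i < k.+1) h i * deep_below (k.+1 - i) i T
   + fringe_sum (deep_path k 1) T)%N.
Proof.
elim: T h => [|a IHa b IHb] h h0.
  rewrite big_nat big1 // => i /andP[_ ik]; rewrite subSn //=; lia.
rewrite [LHS]/= IHa ?IHb //=.
have -> : (\sum_(1 <= i < k.+1) h i * deep_below (k.+1 - i) i (Graft a b) =
  \sum_(1 <= i < k.+1) h i * deep_path (k - i) i.+1 a +
  \sum_(1 <= i < k.+1) h i * deep_below (k.+1 - i) i b)%N.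
  rewrite -big_split; apply: eq_big_nat => i /andP[_ ik].
  by rewrite subSn //= -mulnDr.
suff : ((deep k.+1 a && h k) + \sum_(1 <= i < k.+1)
      (deep i a && h i.-1) * deep_below (k.+1 - i) i a
    = deep_path k 1 a + \sum_(1 <= i < k.+1) h i * deep_path (k - i) i.+1 a)%N.
  set x := fringe_sum _ a; set y := fringe_sum _ b.
  rewrite ?natrDE; lia.
transitivity (\sum_(0 <= i < k.+1) h i * deep_path (k - i) i.+1 a)%N; last first.
  by rewrite big_nat_recl // subn0 h0 mul1n; congr addn; rewrite big_add1.
rewrite [RHS]big_nat_recr // subnn /deep_path deep_below0 muln1.
rewrite [RHS]addnC mulnb andbC big_add1; congr addn; apply: eq_big_nat => i _.
by rewrite -mulnb /= subSS; lia.
Qed.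

Lemma deep_below_edges j i T : (deep_below j i T <= (edges T).+1)%N.
Proof.
elim: T j i => [|a IHa b IHb] [|j] i //=.
have := IHa j i.+1; have := IHb j.+1 i; case: (deep i.+1 a) => /=; lia.
Qed.

(** A node of rank at least [k] has at least [k] descendants. This crude bound
    keeps mass from escaping to infinite rank. *)
Lemma high_rank_deep k h T :
  (high_rank k h T <= fringe_sum (fun T => (k <= edges T) : nat) T)%N.
Proof.
elim: T h => [|a IHa b IHb] h //=; rewrite !natrDE.
do 2?apply: leq_add => //.
by case: (boolP (deep k a)) => //= /deep_edges ->; case: (h _).
Qed.

Section Expectation.
Variable R : realType.
Implicit Types (phi psi : rtree -> R).

Definition grow_sum phi (T : rtree) : R := \sum_(T' <- grow T) phi T'.

Definition rrt_mean (n : nat) phi : R := n`!%:R^-1 * \sum_(T <- grown n) phi T.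

Lemma grow_sumG phi a b :
  grow_sum phi (Graft a b) =
  grow_sum (fun a' => phi (Graft a' b)) a + grow_sum (fun b' => phi (Graft a b')) b.
Proof. by rewrite /grow_sum /= big_cat !big_map. Qed.

Lemma size_grow T : size (grow T) = (edges T).+1.
Proof. by elim: T => //= a IHa b IHb; rewrite size_cat !size_map IHa IHb; lia. Qed.

Lemma edges_grow T : all (fun T' => edges T' == (edges T).+1) (grow T).
Proof.
elim: T => //= a IHa b IHb; rewrite all_cat !all_map.
apply/andP; split; [apply: sub_all IHa|apply: sub_all IHb] => T' /= /eqP ->; lia.
Qed.

Lemma edges_grown n : all (fun T => edges T == n) (grown n).
Proof.
elim: n => //= n; elim: (grown n) => //= T s IH /andP[/eqP eT /IH].
by rewrite all_cat => ->; rewrite andbT -eT edges_grow.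
Qed.

Lemma size_grown n : size (grown n) = n`!.
Proof.
elim: n => //= n; rewrite factS => <-; have := edges_grown n.
elim: (grown n) => [|T s IH] /=; first by rewrite muln0.
by move=> /andP[/eqP eT /IH]; rewrite size_cat size_grow eT mulnS => ->.
Qed.

Lemma rrt_meanS n phi : rrt_mean n.+1 phi = n.+1%:R^-1 * rrt_mean n (grow_sum phi).
Proof.
rewrite /rrt_mean factS natrM invfM -mulrA; congr (_ * (_ * _)).
by rewrite [LHS]/= big_flatten big_map.
Qed.

Lemma rrt_mean_grow n phi : rrt_mean n (grow_sum phi) = n.+1%:R * rrt_mean n.+1 phi.
Proof. by rewrite rrt_meanS mulVKf // pnatr_eq0. Qed.

Lemma rrt_mean0 phi : rrt_mean 0 phi = phi Single.
Proof. by rewrite /rrt_mean /= big_seq1 fact0 invr1 mul1r. Qed.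

Lemma rrt_mean_le n phi psi :
  (forall T, edges T = n -> phi T <= psi T) -> rrt_mean n phi <= rrt_mean n psi.
Proof.
move=> le; rewrite ler_wpM2l ?invr_ge0 //; have := edges_grown n.
elim: (grown n) => [|T s IH] /=; first by rewrite !big_nil.
by move=> /andP[/eqP /le ? /IH ?]; rewrite !big_cons lerD.
Qed.

Lemma eq_rrt_mean n phi psi :
  (forall T, edges T = n -> phi T = psi T) -> rrt_mean n phi = rrt_mean n psi.
Proof.
by move=> e; apply/eqP; rewrite eq_le !rrt_mean_le // => T /e ->.
Qed.

Lemma rrt_meanD n phi psi :
  rrt_mean n (fun T => phi T + psi T) = rrt_mean n phi + rrt_mean n psi.
Proof. by rewrite /rrt_mean big_split mulrDr. Qed.

Lemma rrt_meanZ n c phi : rrt_mean n (fun T => c * phi T) = c * rrt_mean n phi.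
Proof. by rewrite /rrt_mean -mulr_sumr mulrCA. Qed.

Lemma rrt_meanZr n c phi : rrt_mean n (fun T => phi T * c) = rrt_mean n phi * c.
Proof. by rewrite /rrt_mean -mulr_suml mulrA. Qed.

Lemma rrt_mean_cst n c : rrt_mean n (fun=> c) = c.
Proof.
rewrite /rrt_mean big_const_seq count_predT size_grown iter_addr_0 -[c *+ _]mulr_natl.
by rewrite mulKf // pnatr_eq0 -lt0n fact_gt0.
Qed.

Lemma rrt_mean_ge0 n phi : (forall T, 0 <= phi T) -> 0 <= rrt_mean n phi.
Proof. by move=> p0; rewrite -(rrt_mean_cst n 0) rrt_mean_le. Qed.

(** The splitting property: the fringe subtree of the first child of the root
    has uniform size, and given the sizes it and the remaining tree are
    independent random recursive trees. Growth proves it by induction, as a new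
    node falls in either part with probability proportional to its size. *)
Lemma rrt_mean_split n phi :
  rrt_mean n.+1 phi = n.+1%:R^-1 *
  \sum_(i < n.+1) rrt_mean i (fun a => rrt_mean (n - i) (fun b => phi (Graft a b))).
Proof.
elim: n phi => [|n IH] phi.
  by rewrite rrt_meanS big_ord1 !rrt_mean0 /grow_sum big_seq1.
rewrite rrt_meanS IH; congr (_ * _).
(* Each pair of sizes (i, j) is reached from (i.-1, j) with weight i and from
   (i, j.-1) with weight j, which add up to the same total for all pairs. *)
pose X i j := rrt_mean i (fun a => rrt_mean j (fun b => phi (Graft a b))).
have XE (i : 'I_n.+1) :
    rrt_mean i (fun a => rrt_mean (n - i) (fun b => grow_sum phi (Graft a b))) =
    i.+1%:R * X i.+1 (n.+1 - i.+1)%N + (n.+1 - i)%:R * X i (n.+1 - i)%N.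
  transitivity (rrt_mean i (fun a =>
      rrt_mean (n - i) (fun b => grow_sum (fun a' => phi (Graft a' b)) a) +
      rrt_mean (n - i) (grow_sum (fun b => phi (Graft a b))))).
    by apply: eq_rrt_mean => a _; rewrite -rrt_meanD; apply: eq_rrt_mean => b _; rewrite grow_sumG.
  rewrite rrt_meanD; congr +%R.
    rewrite subSS -rrt_mean_grow; apply: eq_rrt_mean => a _.
    by rewrite /grow_sum /rrt_mean exchange_big mulr_sumr.
  have lein : (i <= n)%N by rewrite -ltnS.
  rewrite /X (subSn lein) -rrt_meanZ; apply: eq_rrt_mean => a _.
  exact: rrt_mean_grow.
under eq_bigr do rewrite XE.
rewrite big_split /= addrC.
rewrite -(big_mkord predT (fun i => (n.+1 - i)%:R * X i (n.+1 - i)%N)).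
rewrite -(big_mkord predT (fun i => i.+1%:R * X i.+1 (n.+1 - i.+1)%N)).
have -> : \sum_(0 <= i < n.+1) (n.+1 - i)%:R * X i (n.+1 - i)%N =
    \sum_(0 <= i < n.+2) (n.+1 - i)%:R * X i (n.+1 - i)%N.
  by rewrite [RHS]big_nat_recr //= subnn mul0r addr0.
have -> : \sum_(0 <= i < n.+1) i.+1%:R * X i.+1 (n.+1 - i.+1)%N =
    \sum_(0 <= i < n.+2) i%:R * X i (n.+1 - i)%N.
  by rewrite [RHS]big_nat_recl //= mul0r add0r.
rewrite -big_split /= big_mkord.
rewrite mulr_sumr; apply: eq_bigr => i _.
have lein : (i <= n.+1)%N by rewrite -ltnS.
by rewrite -mulrDl -natrD (subnK lein) mulKf // pnatr_eq0.
Qed.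

Lemma rrt_mean_splitM n phi (alpha beta : rtree -> R) :
  (forall a b, phi (Graft a b) = alpha a * beta b) ->
  n.+1%:R * rrt_mean n.+1 phi =
  \sum_(i < n.+1) rrt_mean i alpha * rrt_mean (n - i) beta.
Proof.
move=> phiE; rewrite rrt_mean_split mulVKf ?pnatr_eq0 //.
apply: eq_bigr => i _; rewrite -rrt_meanZr; apply: eq_rrt_mean => a _.
by rewrite -rrt_meanZ; apply: eq_rrt_mean => b _; rewrite phiE.
Qed.

(** The splitting property turns the mean of [fringe_sum] into the quicksort
    recurrence, whose solution says that a fringe subtree with [i.+1] nodes has
    asymptotic frequency [1 / (i.+1 * i.+2)]. *)
Lemma rrt_mean_fringe n phi :
  rrt_mean n (fringe_sum phi) / n.+1%:R =
  \sum_(0 <= i < n) rrt_mean i phi / (i.+1%:R * i.+2%:R).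
Proof.
pose y n := rrt_mean n (fringe_sum phi); pose c n := rrt_mean n phi.
have yS m : m.+1%:R * y m.+1 = \sum_(0 <= i < m.+1) (c i + y i *+ 2).
  rewrite /y rrt_mean_split mulVKf ?pnatr_eq0 //.
  transitivity (\sum_(i < m.+1) (c i + y i + y (m - i)%N)).
    apply: eq_bigr => i _; rewrite -[y (m - i)%N](rrt_mean_cst i) -!rrt_meanD.
    apply: eq_rrt_mean => a _ /=.
    by rewrite rrt_meanD rrt_mean_cst.
  rewrite big_split /= [X in _ + X](reindex_inj rev_ord_inj) /=.
  rewrite -big_split big_mkord; apply: eq_bigr => i _ /=.
  have lein : (i <= m)%N by rewrite -ltnS.
  by rewrite subSS (subKn lein) mulr2n addrA.
rewrite -/(y n); elim: n => [|n IH]; first by rewrite /y rrt_mean0 big_nil mul0r.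
rewrite big_nat_recr //= -IH -/(c n).
have {}IH : y n.+1 = (n.+2%:R * y n + c n) / n.+1%:R.
  have n0 : n.+1%:R != 0 :> R by rewrite pnatr_eq0.
  apply: (mulfI n0); rewrite [RHS]mulrC divfK // yS big_nat_recr //=.
  case: n {n0 IH} => [|n]; last by rewrite -yS; ring.
  by rewrite big_nil /y rrt_mean0 /= !mul0rn; ring.
rewrite IH -!natr1; field.
by rewrite !natr1 !pnatr_eq0.
Qed.

End Expectation.

(** * Ranks as leaf-free balls, and trees read off a parent function *)

Section RankRecursion.
Local Open Scope nat_scope.
Variables (T : finType) (e : rel T).

(** The condition that the rank is at least [k], as a recursion along edges:
    letting walks turn back brings no leaf closer. *)
Fixpoint leaf_free (k : nat) (x : T) : bool :=
  if k is k'.+1 then ~~ leaf e x && [forall y, e x y ==> leaf_free k' y] else true.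

Lemma leaf_free_anti k x : leaf_free k.+1 x -> leaf_free k x.
Proof.
elim: k x => // k IH x /andP[lx /forallP fx]; rewrite [leaf_free _ _]/= lx /=.
apply/forallP => y; apply/implyP => exy; apply: IH.
exact: (implyP (fx y)).
Qed.

Lemma walkS d x y : walk e d.+1 x y = [exists z, e x z && walk e d z y].
Proof.
apply/existsP/existsP => [[p]|[z /andP[exz /existsP[p pP]]]].
  case/tupleP: p => z p /= /andP[/andP[exz pz] l].
  by exists z; rewrite exz; apply/existsP; exists p; rewrite pz.
by exists [tuple of z :: p]; rewrite /= exz.
Qed.

Lemma leaf_freeP k x :
  reflect (forall d y, d < k -> leaf e y -> ~~ walk e d x y) (leaf_free k x).
Proof.
apply: (iffP idP); elim: k x => // k IH x.
  move=> /andP[lx /forallP fx] [|d] y dk ly.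
    apply/existsP => -[p]; rewrite tuple0 /= => /eqP xy.
    by rewrite xy ly in lx.
  rewrite walkS; apply/existsP => -[z /andP[exz]]; apply/negP.
  by apply: IH => //; exact: (implyP (fx z)).
move=> nw /=; apply/andP; split.
  apply/negP => /(nw 0 x (ltn0Sn _)) /negP; apply; apply/existsP.
  by exists [tuple]; rewrite /=.
apply/forallP => z; apply/implyP => exz; apply: IH => d y dk ly.
apply: contra (nw d.+1 y _ ly) => // wzy.
by rewrite walkS; apply/existsP; exists z; rewrite exz.
Qed.

Lemma leq_gdist k x y : k <= #|T| ->
  reflect (forall d, d < k -> ~~ walk e d x y) (k <= gdist e x y).
Proof.
move=> kT; rewrite /gdist leqNgt; apply: (iffP idP) => [nf d dk|nw].
  rewrite -leqNgt in nf; have /(before_find 0) := leq_trans dk nf.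
  by rewrite nth_iota ?add0n ?(leq_trans dk) // => ->.
apply/negP => fk.
have h : has (fun d => walk e d x y) (iota 0 #|T|).
  by rewrite has_find size_iota (leq_trans fk).
have := nth_find 0 h; rewrite nth_iota ?add0n ?(leq_trans fk) //.
by rewrite (negbTE (nw _ fk)).
Qed.

(** The bound [k <= #|T|] is due to the default value [#|T|] in the definition of
    the rank. *)
Lemma leq_rank k x : #|T| != 1 -> k <= #|T| -> (k <= rank e x) = leaf_free k x.
Proof.
move=> T1 kT; rewrite /rank (negbTE T1).
have -> : (k <= \big[minn/#|T|]_(y | leaf e y) gdist e x y) =
          [forall (y | leaf e y), k <= gdist e x y].
  apply/idP/forall_inP => [le y ly|le].
    apply: leq_trans le _; move: (mem_index_enum y).
    elim: (index_enum T) => // z r IH; rewrite inE big_cons.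
    case/orP => [/eqP <-|/IH {}IH]; first by rewrite ly geq_minl.
    by case: (leaf e z) => //; rewrite geq_min IH orbT.
  by elim/big_ind: _ => // a b ka kb; rewrite leq_min ka.
apply/forall_inP/leaf_freeP => [le d y dk ly|nw y ly].
  by have /(leq_gdist _ _ kT) := le y ly; apply.
by apply/leq_gdist => // d dk; exact: nw.
Qed.

End RankRecursion.

Section ParentFunction.
Local Open Scope nat_scope.
Implicit Types par : nat -> nat.

(** The tree formed by node [v] and the descendants of its children with labels
    in the window [s, s + m[. No labels need to be stored in the tree. *)
Fixpoint window_tree par (m v s : nat) : rtree :=
  if m is m'.+1 then
    if par s == v then Graft (window_tree par m' s s.+1) (window_tree par m' v s.+1)
    else window_tree par m' v s.+1
  else Single.

Lemma eq_window_tree par par' m v s : (forall c, s <= c < s + m -> par c = par' c) ->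
  window_tree par m v s = window_tree par' m v s.
Proof.
elim: m v s => //= m IH v s e; rewrite e; last lia.
by rewrite !IH // => c /andP[sc cm]; apply: e; lia.
Qed.

Definition subtree_at par n c := window_tree par (n - c.+1) c c.+1.

Lemma kids_deep_window_tree par i n v s : s <= n ->
  reflect (forall c, s <= c < n -> par c = v -> deep i (subtree_at par n c))
          (kids_deep i (window_tree par (n - s) v s)).
Proof.
move=> sn; apply: (iffP idP); move: sn; move def_m: (n - s) => m.
  elim: m s def_m => [|m IH] s def_m sn /=.
    by move=> _ c; lia.
  case: eqVneq => [ps|nps].
    rewrite kids_deepG => /andP[ds ks] c /andP[sc cn] pc.
    move: sc; rewrite leq_eqVlt => /orP[/eqP <-|sc].
      by rewrite /subtree_at (_ : n - s.+1 = m); last lia.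
    by apply: IH ks _ _ pc; lia.
  move=> ks c /andP[sc cn] pc.
  move: sc; rewrite leq_eqVlt => /orP[/eqP sc|sc].
    by rewrite sc pc eqxx in nps.
  by apply: IH ks _ _ pc; lia.
elim: m s def_m => [|m IH] s def_m sn //= dc.
have ks : kids_deep i (window_tree par m v s.+1).
  by apply: IH; try lia; move=> c cn; apply: dc; lia.
case: eqVneq => // ps; rewrite kids_deepG ks andbT.
by have := dc s _ ps; rewrite /subtree_at (_ : n - s.+1 = m); [apply|]; lia.
Qed.

Lemma single_window_tree par n v s : s <= n ->
  reflect (forall c, s <= c < n -> par c != v) (single (window_tree par (n - s) v s)).
Proof.
move=> sn; apply: (iffP idP); move: sn; move def_m: (n - s) => m.
  elim: m s def_m => [|m IH] s def_m sn /=; first by move=> _ c; lia.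
  case: eqVneq => // nps ks c /andP[sc cn].
  move: sc; rewrite leq_eqVlt => /orP[/eqP <-//|sc].
  by apply: IH ks _ _; lia.
elim: m s def_m => [|m IH] s def_m sn //= dc.
rewrite (negbTE (dc s _)); last lia.
by apply: IH; try lia; move=> c cn; apply: dc; lia.
Qed.

Definition with_last par (n p c : nat) := if c == n then p else par c.

(** Summing over the parent of an additional node [n] amounts to growing one of
    the trees of the forest rooted at the nodes below [s]. The functional [Phi] sees
    the whole forest because the induction on the window merges the tree of node
    [s] into that of its parent. *)
Lemma sum_window_tree_grow (V : nmodType) par n s (Phi : (nat -> rtree) -> V) :
  s <= n -> (forall c, s <= c < n -> par c < c) ->
  (forall F F', (forall v, v < s -> F v = F' v) -> Phi F = Phi F') ->
  (\sum_(p < n) Phi (fun v => window_tree (with_last par n p) (n.+1 - s) v s) =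
   \sum_(v < s) \sum_(T <- grow (window_tree par (n - s) v s))
      Phi (fun u => if u == v then T else window_tree par (n - s) u s))%R.
Proof.
move def_m: (n - s) => m.
elim: m s Phi def_m => [|m IH] s Phi def_m sn par_lt PhiE.
  have -> : s = n by lia.
  apply: eq_bigr => v _; rewrite subSnn /= big_seq1; congr Phi; apply: funext => u.
  by rewrite /with_last eqxx eq_sym.
rewrite (_ : n.+1 - s = m.+2); last lia.
set q := par s.
have qs : q < s by apply: par_lt; lia.
pose Psi (F : nat -> rtree) := Phi (fun v => if q == v then Graft (F s) (F v) else F v).
have := IH s.+1 Psi.
rewrite (_ : n.+1 - s.+1 = m.+1); last lia.
move=> {}IH; transitivity (\sum_(p < n) Psi
    (fun v : nat => window_tree (with_last par n p) m.+1 v s.+1))%R.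
  apply: eq_bigr => p _; congr Phi; apply: funext => v.
  by rewrite [LHS]/= [with_last _ _ _ s]ifN; last by apply/eqP; lia.
rewrite IH; try lia; first last.
- move=> F F' FE; apply: PhiE => v vs; case: eqP => _; rewrite !FE //; lia.
- move=> c cn; apply: par_lt; lia.
set B := fun v => window_tree par m v s.+1.
rewrite big_ord_recr /=.
have BE v : window_tree par m.+1 v s = if q == v then Graft (B s) (B v) else B v by [].
rewrite (bigD1 (Ordinal qs)) //= [RHS](bigD1 (Ordinal qs)) //=.
rewrite -/q eqxx /= big_cat !big_map /=.
rewrite -/(B q) -/(B s).
rewrite [LHS]addrC [LHS]addrA; congr (_ + _ + _)%R.
- apply: eq_bigr => T _; apply: PhiE => u us /=.
  rewrite eqxx (ltn_eqF us).
  by case: (eqVneq q u) => [<-|].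
- apply: eq_bigr => T _; apply: PhiE => u us /=.
  by rewrite (gtn_eqF qs); case: (eqVneq q u).
apply: eq_bigr => v vq.
have {vq}qv : (q == v) = false.
  by apply: contraNF vq => /eqP qv; apply/eqP/val_inj.
rewrite qv; apply: eq_bigr => T _; apply: PhiE => u us /=.
rewrite (gtn_eqF (ltn_ord v)).
case: (eqVneq q u) => [<-|//].
by rewrite qv.
Qed.

End ParentFunction.

(** * The random recursive tree as a uniformly grown tree *)

Section Choices.
Local Open Scope nat_scope.

Definition parent (n : nat) (w : rrt_choice n) (c : nat) : nat :=
  if @insub nat (fun i => i < n.-1) 'I_n.-1 c.-1 is Some t then w t else 0.

Lemma parentE n (w : rrt_choice n) (t : 'I_n.-1) : parent w t.+1 = w t.
Proof. by rewrite /parent /= valK. Qed.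

Lemma parent_lt n (w : rrt_choice n) c : 0 < c < n -> parent w c < c.
Proof.
case: c => // t; case: n w => // n w /andP[_]; rewrite ltnS => tn.
by have := parentE w (Ordinal tn) => /= ->; exact: ltn_ord.
Qed.

Definition rrt_tree n (w : rrt_choice n.+1) : rtree := window_tree (parent w) n 0 1.

Lemma rrt_edgeE n (w : rrt_choice n) (u v : 'I_n) :
  rrt_edge w u v =
  (0 < u) && (parent w u == v) || (0 < v) && (parent w v == u).
Proof.
apply/existsP/orP => [[t /orP[] /andP[/eqP -> /eqP ->]]|].
- by left; rewrite parentE eqxx.
- by right; rewrite parentE eqxx.
have aux (x y : 'I_n) : 0 < x -> parent w x == y ->
    exists t : 'I_n.-1, (x == t.+1 :> nat) && (y == w t :> nat).
  case: x => -[//|t] /= tn _ /eqP <-.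
  have tn' : t < n.-1 by case: (n) tn.
  by exists (Ordinal tn'); rewrite -(parentE w (Ordinal tn')) /= !eqxx.
by move=> -[] /andP[] /aux/[apply] -[t tP]; exists t; rewrite tP ?orbT.
Qed.

Section Ranks.
Variables (n : nat) (w : rrt_choice n).
Let e := rrt_edge w.
Let par := parent w.

Lemma leaf_nonroot (v : 'I_n) : 0 < v ->
  leaf e v = single (subtree_at par n v).
Proof.
move=> v0; have pvv : par v < v by rewrite parent_lt ?v0 /=.
have [p pE] : exists p : 'I_n, par v = p by exists (Ordinal (ltn_trans pvv (ltn_ord v))).
have ep : e v p by rewrite /e rrt_edgeE v0 -/par pE eqxx.
rewrite /leaf /degree; apply/idP/single_window_tree => //; last first.
  move=> nc; rewrite (eq_card (B := pred1 p)) ?card1 // => y.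
  rewrite !inE /e rrt_edgeE v0 /=; apply/orP/eqP => [[/eqP E|/andP[y0 /eqP E]]|->].
  - by apply: val_inj; rewrite /= -pE /par E.
  - have vy : v < y by rewrite -E parent_lt ?y0 /=.
    by have := nc y; rewrite vy ltn_ord /par E eqxx => /(_ isT).
  - by left; rewrite -pE.
move=> /card1P[x xP] c /andP[vc cn]; apply/eqP => pc.
have ec : e v (Ordinal cn).
  by rewrite /e rrt_edgeE /= (leq_trans _ vc) //= -/par pc eqxx orbT.
have /eqP cx : Ordinal cn == x by rewrite -[_ == _]/(Ordinal cn \in pred1 x) -xP.
have /eqP px : p == x by rewrite -[_ == _]/(p \in pred1 x) -xP.
have : c = p by rewrite px -cx.
by move=> E; move: vc; rewrite E -pE ltnNge (ltnW pvv).
Qed.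

(** A leaf nearest to a node [v] other than the root lies below [v] or is
    reached through its parent, and the rank changes by at most one along an
    edge. The root has to be excluded, since it may be a leaf with one child. *)
Lemma leaf_free_nonroot i (v p : 'I_n) : 0 < v -> par v = p ->
  leaf_free e i v = deep i (subtree_at par n v) && leaf_free e i.-1 p.
Proof.
have [k ik] := ubnP i; elim: k i ik v p => // k IH [|[|i]] ik v p v0 pv //.
  rewrite andbT [LHS]/= leaf_nonroot // deepSE; congr andb.
  have -> : kids_deep 0 (subtree_at par n v) by apply/kids_deep_window_tree.
  by apply/forallP => y; rewrite implybT.
have edge_p : e v p by rewrite /e rrt_edgeE v0 -/par pv eqxx.
rewrite [LHS]/= leaf_nonroot //.
apply/andP/andP => [[lv /forallP fy]|[dv fp]].
  split; last exact: (implyP (fy p)).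
  rewrite deepSE lv; apply/kids_deep_window_tree => // c /andP[vc cn] pc.
  have := implyP (fy (Ordinal cn)); rewrite /e rrt_edgeE /= -/par pc eqxx andbT.
  rewrite (leq_trans _ vc) //= orbT => /(_ isT) /=.
  rewrite -[_ && _]/(leaf_free e i.+1 (Ordinal cn)).
  by rewrite (IH i.+1 _ _ v) ?(leq_trans _ vc) // => /andP[].
have /andP[lv kv] : deep i.+2 (subtree_at par n v) by [].
split=> //; apply/forallP => y; apply/implyP.
rewrite /e rrt_edgeE v0 /= -/par pv => /orP[/eqP py|/andP[y0 /eqP pyv]].
  by rewrite (_ : y = p) //; exact/val_inj.
rewrite -[_ && _]/(leaf_free e i.+1 y).
rewrite (IH i.+1 _ _ v) //; apply/andP; split.
  move/kids_deep_window_tree: kv; apply; rewrite // ltn_ord andbT -pyv.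
  by rewrite parent_lt ?y0 ?ltn_ord.
rewrite (IH i _ _ p) //=; last lia.
rewrite (deep_leq _ dv) /=; last lia.
by case: i fp {IH ik dv kv} => // i /leaf_free_anti /leaf_free_anti.
Qed.

End Ranks.

(** Each node [c >= s] descends from exactly one [v < s]. Enlarging [s] by one
    moves the count of node [s] itself out of the tree of its parent. *)
Lemma sum_high_rank n (w : rrt_choice n.+1) k s : 0 < s <= n.+1 ->
  \sum_(v < s) high_rank k
     (fun i => leaf_free (rrt_edge w) i (inord v)) (window_tree (parent w) (n.+1 - s) v s) =
  \sum_(s <= c < n.+1) leaf_free (rrt_edge w) k (inord c).
Proof.
move def_m: (n.+1 - s) => m.
elim: m s def_m => [|m IH] s def_m sn.
  by rewrite big1 // big_geq //; lia.
have sn1 : s < n.+1 by lia.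
rewrite [RHS]big_ltn // -IH; try lia.
rewrite [in RHS]big_ord_recr /= addnA.
have ps : parent w s < s by rewrite parent_lt //; lia.
rewrite (bigD1 (Ordinal ps)) //= [in RHS](bigD1 (Ordinal ps)) //= eqxx.
have haE i : deep i (window_tree (parent w) m s s.+1) &&
    leaf_free (rrt_edge w) i.-1 (inord (parent w s)) = leaf_free (rrt_edge w) i (inord s).
  rewrite (@leaf_free_nonroot _ w i (inord s) (inord (parent w s))).
  - by rewrite /subtree_at (inordK sn1) (_ : n.+1 - s.+1 = m) //; lia.
  - by rewrite (inordK sn1); lia.
  - by rewrite (inordK sn1) (inordK (ltn_trans ps sn1)).
rewrite [high_rank k _ (Graft _ _)]/= haE (funext haE).
set x := \sum_(_ < _ | _) _; set y := \sum_(_ < _ | _) _.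
have -> : x = y.
  apply: eq_bigr => v vp; case: eqP => // E.
  by move: vp; rewrite -[v != _]/(val v != parent w s) E eqxx.
rewrite /=; lia.
Qed.

Lemma rank_count_ge n (w : rrt_choice n.+2) k : k <= n.+2 ->
  #|[pred v : 'I_n.+2 | k <= rank (rrt_edge w) v]| =
  leaf_free (rrt_edge w) k ord0 +
  high_rank k (fun i => leaf_free (rrt_edge w) i ord0) (rrt_tree w).
Proof.
move=> kn.
have -> : ord0 = inord 0 :> 'I_n.+2 by apply: val_inj; rewrite /= inordK.
have := @sum_high_rank n.+1 w k 1 isT; rewrite big_ord1 subSS subn0 => ->.
rewrite -(big_ltn (F := fun c => nat_of_bool (leaf_free (rrt_edge w) k (inord c)))) //.
rewrite big_mkord -sum1_card [LHS]big_mkcond /=; apply: eq_bigr => v _.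
by rewrite inord_val inE leq_rank ?card_ord //; case: leaf_free.
Qed.

Lemma parent_inj n (w w' : rrt_choice n) :
  (forall t, t < n.-1 -> parent w t.+1 = parent w' t.+1) -> w = w'.
Proof.
move=> E; apply/ffunP => t; apply: val_inj.
by rewrite -[LHS]parentE -[RHS]parentE E.
Qed.

(** Choices are rebuilt from the parent function since their components have
    different types. *)
Definition extend n (q : rrt_choice n.+1 * 'I_n.+1) : rrt_choice n.+2 :=
  [ffun t : 'I_n.+1 => inord (with_last (parent q.1) n.+1 q.2 t.+1)].

Lemma parent_extend n (q : rrt_choice n.+1 * 'I_n.+1) c : 0 < c < n.+2 ->
  parent (extend q) c = with_last (parent q.1) n.+1 q.2 c.
Proof.
case: c => // t /andP[_]; rewrite ltnS => tn.
have := parentE (extend q) (Ordinal tn) => /= ->; rewrite ffunE inordK //=.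
rewrite /with_last; case: eqVneq => [[->]|tn']; first exact: ltn_ord.
by apply: parent_lt; lia.
Qed.

Lemma extend_bij n : bijective (@extend n).
Proof.
pose res (w : rrt_choice n.+2) : rrt_choice n.+1 * 'I_n.+1 :=
  ([ffun t : 'I_n => inord (parent w t.+1)], inord (parent w n.+1)).
exists res => [[w p]|w].
  congr pair; last first.
    apply: val_inj; rewrite /= parent_extend ?leqnn // /with_last eqxx.
    by rewrite inordK.
  apply/ffunP => t; apply: val_inj; rewrite /= ffunE /= parent_extend /=; last first.
    exact: ltnW (ltn_ord t).
  rewrite /with_last ltn_eqF; last exact: ltn_ord t.
  rewrite parentE inordK //; exact: ltn_ord.
apply: parent_inj => t tn; rewrite parent_extend //= /with_last.
case: eqVneq => [->|tn']; first by rewrite inordK // parent_lt /=.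
have tn1 : t < n by lia.
have := parentE (n := n.+1) [ffun t : 'I_n => inord (parent w t.+1)] (Ordinal tn1).
move=> /= ->; rewrite ffunE /= inordK //; apply: parent_lt; lia.
Qed.

End Choices.

Section Law.
Variable R : realType.

Lemma sum_rrt_tree n (phi : rtree -> R) :
  \sum_(w : rrt_choice n.+1) phi (rrt_tree w) = \sum_(T <- grown n) phi T.
Proof.
elim: n phi => [|n IH] phi.
  pose w0 : rrt_choice 1 := [ffun t : 'I_0 => ord0].
  rewrite /= big_seq1 (big_pred1 w0) // => w /=.
  by apply/esym/eqP/ffunP => -[].
rewrite (reindex (@extend n)) /=; last exact/onW_bij/extend_bij.
rewrite big_flatten big_map -IH.
rewrite -(pair_bigA _ (fun (w : rrt_choice n.+1) p => phi (rrt_tree (@extend n (w, p))))) /=.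
apply: eq_bigr => w _.
transitivity (\sum_(p < n.+1)
    phi (window_tree (with_last (@parent n.+1 w) n.+1 p) n.+1 0 1)).
  apply: eq_bigr => p _; congr phi; apply: eq_window_tree => c cn.
  by rewrite parent_extend.
have := @sum_window_tree_grow _ (@parent n.+1 w) n.+1 1 (fun F => phi (F 0%N)).
rewrite big_ord1 !subSS !subn0 /= => -> //.
- by move=> c cn; apply: parent_lt.
- by move=> F F' ->.
Qed.

(** All choices have the same probability, and adding the choice of the last
    node is one step of growth. *)
Lemma rrt_expect_tree n (phi : rtree -> R) :
  rrt_expect (fun w : rrt_choice n.+1 => phi (rrt_tree w)) = rrt_mean n phi.
Proof.
rewrite /rrt_expect /rrt_mean -sum_rrt_tree mulr_sumr; apply: eq_bigr => w _.
congr (_ * _); rewrite /rrt_prob /=.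
elim: n {phi w} => [|n IH]; first by rewrite big_ord0 fact0 invr1.
by rewrite big_ord_recr /= IH factS natrM invfM mulrC.
Qed.

End Law.

(** * The limiting cumulative distribution as a series *)

Section Limits.
Variable R : realType.

(** The sum over the nodes of two to the power minus their depth. *)
Fixpoint depth_weight (T : rtree) : R :=
  if T is Graft a b then depth_weight a / 2 + depth_weight b else 1.

Lemma depth_weight_ge1 T : 1 <= depth_weight T.
Proof. by elim: T => //= a IHa b IHb; lra. Qed.

Lemma grow_sum_depth_weight T :
  grow_sum depth_weight T = ((edges T).+1%:R + 2^-1) * depth_weight T.
Proof.
elim: T => [|a IHa b IHb]; first by rewrite /grow_sum big_seq1 /=; lra.
have cst c (t : seq rtree) : \sum_(x <- t) (c : R) = (size t)%:R * c.
  by rewrite big_const_seq count_predT iter_addr_0 -[c *+ _]mulr_natl.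
have -> : grow_sum depth_weight (Graft a b) =
    grow_sum depth_weight a / 2 + (size (grow a))%:R * depth_weight b +
    ((size (grow b))%:R * (depth_weight a / 2) + grow_sum depth_weight b).
  rewrite grow_sumG /grow_sum /= !big_split /= !cst -mulr_suml; ring.
rewrite IHa IHb !size_grow /= -addSn -addnS natrD; lra.
Qed.

(** One growth step multiplies the mean by [1 + 1 / (2 * n.+1)], so that it grows
    like the square root of the number of nodes. *)
Lemma mean_depth_weight n : rrt_mean n depth_weight ^+ 2 <= n.*2.+1%:R.
Proof.
elim: n => [|n IH]; first by rewrite rrt_mean0 /= expr1n.
have n0 : (n.+1%:R : R) != 0 by rewrite pnatr_eq0.
have -> : rrt_mean n.+1 depth_weight = (1 + (2 * n.+1%:R)^-1) * rrt_mean n depth_weight.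
  rewrite rrt_meanS (@eq_rrt_mean _ n _ (fun T => (n.+1%:R + 2^-1) * depth_weight T)).
    by rewrite rrt_meanZ mulrA; congr (_ * _); field.
  by move=> T eT; rewrite grow_sum_depth_weight eT.
rewrite exprMn.
apply: (le_trans (ler_wpM2l (sqr_ge0 _) IH)).
have -> : (n.+1.*2.+1%:R : R) = 2 * n.+1%:R + 1 by rewrite -muln2 -natr1 natrM mulrC.
have -> : (n.*2.+1%:R : R) = 2 * n.+1%:R - 1.
  by rewrite -muln2 -!natr1 natrM; ring.
have : (0 : R) < n.+1%:R by rewrite ltr0n.
move: (n.+1%:R) n0 => x x0 xp.
have -> : (1 + (2 * x)^-1) ^+ 2 * (2 * x - 1) =
          2 * x + 1 - (2 * x + 1) / (4 * x ^+ 2) by field.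
by rewrite gerBl divr_ge0 // ?mulr_ge0 ?sqr_ge0 //; lra.
Qed.

Lemma mean_depth_weight_cvg :
  (fun n => rrt_mean n depth_weight / n.+1%:R) @ \oo --> (0 : R).
Proof.
have sq : (Num.sqrt \o (fun n => 2 * n.+1%:R^-1 : R)) @ \oo --> (0 : R).
  rewrite -[X in _ --> X](sqrtr0 R).
  apply: continuous_cvg.
    exact: sqrt_continuous.
  rewrite -[X in _ --> X](mulr0 2); apply: cvgMr; exact: cvg_harmonic.
apply: squeeze_cvgr (cvg_cst 0) sq.
near=> n; have m0 : 0 <= rrt_mean n depth_weight.
  by apply: rrt_mean_ge0 => T; rewrite (le_trans _ (depth_weight_ge1 T)).
rewrite divr_ge0 //=.
rewrite -[leLHS]ger0_norm ?divr_ge0 // -sqrtr_sqr ler_wsqrtr //.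
rewrite exprMn exprVn ler_pdivrMr ?exprn_gt0 // [X in _ <= _ * X]expr2 mulrA divfK ?pnatr_eq0 //.
rewrite (le_trans (mean_depth_weight n)) // -natrM ler_nat; lia.
Unshelve. all: by end_near.
Qed.

(** With [mean_depth_weight_cvg], nodes at bounded depth form a negligible
    fraction of the tree. *)
Lemma deep_below_depth_weight j i T :
  (deep_below j i T)%:R <= 2 ^+ j * depth_weight T.
Proof.
elim: T j i => [|a IHa b IHb] j i.
  by case: j => [|j] /=; rewrite mulr1 ?exprn_ge0 // expr0.
case: j => [|j]; first by rewrite deep_below0 expr0 mul1r depth_weight_ge1.
rewrite /= natrD mulrDr lerD // ?IHb //.
have -> : 2 ^+ j.+1 * (depth_weight a / 2) = 2 ^+ j * depth_weight a.
  by rewrite exprS; field.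
apply: (le_trans _ (IHa j i.+1)); rewrite ler_nat.
by case: (deep i.+1 a); rewrite ?mul1n.
Qed.

(** The asymptotic frequency of the nodes of rank at least [k.+1] whose ancestor
    at distance [k] has [i] descendants. *)
Definition path_mean k i : R :=
  rrt_mean i (fun T => (deep_path k 1 T)%:R) / (i.+1%:R * i.+2%:R).

Lemma path_mean_ge0 k i : 0 <= path_mean k i.
Proof. by apply: divr_ge0; [exact: rrt_mean_ge0 | exact: mulr_ge0]. Qed.

Lemma fringe_sum_natr (phi : rtree -> nat) T :
  (fringe_sum phi T)%:R = fringe_sum (fun T => (phi T)%:R : R) T.
Proof. by elim: T => //= a <- b <-; rewrite !natrD. Qed.

Lemma path_mean_sum k n :
  rrt_mean n (fun T => (fringe_sum (deep_path k 1) T)%:R) / n.+1%:R =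
  \sum_(0 <= i < n) path_mean k i.
Proof.
rewrite /path_mean -rrt_mean_fringe; congr (_ / _).
by apply: eq_rrt_mean => T _; exact: fringe_sum_natr.
Qed.

(** Beyond the bound itself, its decay in [k] shows that the limiting ranks
    carry total mass one. *)
Lemma path_mean_sum_le k n : \sum_(0 <= i < n) path_mean k i <= k.+2%:R^-1.
Proof.
rewrite -path_mean_sum.
pose big T := fringe_sum (fun T => (k.+1 <= edges T)%N%:R : R) T.
apply: (@le_trans _ _ (rrt_mean n big / n.+1%:R)).
  rewrite ler_wpM2r ?invr_ge0 // rrt_mean_le // => T _.
  rewrite /big -(fringe_sum_natr (fun T => (k.+1 <= edges T)%N : nat)) ler_nat.
  apply: leq_trans (high_rank_deep k.+1 (fun=> true) T).
  by rewrite high_rankE // leq_addl.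
rewrite rrt_mean_fringe.
(* The frequencies with i > k telescope; the truncation by maxn cancels the
   others. *)
pose u i : R := - (maxn i k.+1).+1%:R^-1.
rewrite (eq_big_nat _ _ (F2 := fun i => u i.+1 - u i)) => [|i _].
  by rewrite telescope_sumr // /u opprK max0n gerDr oppr_le0 invr_ge0.
rewrite (@eq_rrt_mean _ _ _ (fun=> (k < i)%N%:R)); last by move=> T ->.
rewrite rrt_mean_cst /u; have [ki|ki] := ltnP k i.
  rewrite !(maxn_idPl _) ?(leqW ki) // -!natr1.
  by field; rewrite !natr1 !pnatr_eq0.
by rewrite !(maxn_idPr _) ?subrr ?mul0r // leqW.
Qed.

Lemma path_mean_cvg k : cvgn (series (path_mean k)).
Proof.
apply: nondecreasing_is_cvgn; first by apply: nondecreasing_series => i _ _; exact: path_mean_ge0.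
by exists k.+2%:R^-1 => _ [n _ <-]; exact: path_mean_sum_le.
Qed.

Definition rank_tail k n : R :=
  rrt_expect (fun w : rrt_choice n =>
    #|[pred v : 'I_n | (k <= rank (rrt_edge w) v)%N]|%:R / n%:R).

Lemma rrt_expectB n (X Y : rrt_choice n -> R) :
  rrt_expect (fun w => X w - Y w) = rrt_expect X - rrt_expect Y.
Proof. by rewrite /rrt_expect -sumrB; apply: eq_bigr => w _; rewrite mulrBr. Qed.

Lemma rrt_expect_le n (X Y : rrt_choice n -> R) :
  (forall w, X w <= Y w) -> rrt_expect X <= rrt_expect Y.
Proof.
move=> XY; apply: ler_sum => w _; apply: ler_wpM2l => //.
by apply: prodr_ge0 => i _; rewrite invr_ge0.
Qed.

Lemma rank_freqE k n : rank_freq R k n = rank_tail k n - rank_tail k.+1 n.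
Proof.
rewrite /rank_freq /rank_tail -rrt_expectB; congr rrt_expect; apply/funext => w.
rewrite -mulrBl; congr (_ / _); apply/eqP; rewrite eq_sym subr_eq -natrD eqr_nat.
rewrite /rank_count -cardUI [X in (_ + X)%N]eq_card0 ?addn0; last first.
  move=> v; rewrite !inE; case: eqVneq => //= ->; exact: ltnn.
apply/eqP/eq_card => v; rewrite !inE leq_eqVlt eq_sym.
by rewrite [rank _ _ == k]eq_sym.
Qed.

Lemma rank_tail0_cvg : rank_tail 0 @ \oo --> (1 : R).
Proof.
apply: cvg_near_cst; exists 1%N => // -[//|n] _ /=.
rewrite /rank_tail -[RHS](rrt_mean_cst n) -rrt_expect_tree.
congr rrt_expect; apply/funext => w.
by rewrite (eq_card (B := 'I_n.+1)) // card_ord divff // pnatr_eq0.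
Qed.

(** By [high_rankE] the count of nodes of rank at least [k.+1] differs from the
    fringe sum only by the root and by nodes at depth at most [k]. *)
Lemma rank_tailS_cvg k : rank_tail k.+1 @ \oo --> limn (series (path_mean k)).
Proof.
rewrite -(cvg_shiftS (rank_tail k.+1)).
pose c : R := k.+1%:R * 2 ^+ k.+1.
pose z n : R := rrt_mean n depth_weight / n.+1%:R.
apply: (squeeze_cvgr (f := series (path_mean k))
    (h := fun n => n.+1%:R^-1 + series (path_mean k) n + c * z n)); last first.
- rewrite -[X in _ --> X]addr0 -[X in _ --> X + _]add0r.
  apply: cvgD; first by apply: cvgD; [exact: cvg_harmonic|exact: path_mean_cvg].
  rewrite -[X in _ --> X](mulr0 c); apply: cvgMr; exact: mean_depth_weight_cvg.
- exact: path_mean_cvg.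
exists (maxn k 1) => // n /= kn.
case: n kn => [|n] kn; first by lia.
rewrite /series /= -!path_mean_sum.
have lo (w : rrt_choice n.+2) :
    (fringe_sum (deep_path k 1) (rrt_tree w))%:R / n.+2%:R <=
    #|[pred v : 'I_n.+2 | (k.+1 <= rank (rrt_edge w) v)%N]|%:R / n.+2%:R :> R.
  rewrite ler_wpM2r ?invr_ge0 // ler_nat rank_count_ge; last by lia.
  by rewrite high_rankE //; lia.
have hi (w : rrt_choice n.+2) :
    #|[pred v : 'I_n.+2 | (k.+1 <= rank (rrt_edge w) v)%N]|%:R / n.+2%:R <=
    (1 + (fringe_sum (deep_path k 1) (rrt_tree w))%:R + c * depth_weight (rrt_tree w)) / n.+2%:R :> R.
  rewrite ler_wpM2r ?invr_ge0 // rank_count_ge; last by lia.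
  rewrite high_rankE // !natrD addrA addrAC.
  apply: lerD; first by rewrite lerD2r; case: leaf_free.
  have hd0 : 0 <= depth_weight (rrt_tree w) by rewrite (le_trans _ (depth_weight_ge1 _)).
  rewrite natr_sum; apply: (@le_trans _ _
      (\sum_(1 <= i < k.+1) 2 ^+ k.+1 * depth_weight (rrt_tree w))).
    rewrite !big_nat; apply: ler_sum => i /andP[i1 ik].
    apply: (@le_trans _ _ (2 ^+ (k.+1 - i) * depth_weight (rrt_tree w))).
      apply: le_trans (deep_below_depth_weight _ i _); rewrite ler_nat.
      by case: leaf_free; rewrite ?mul1n.
    by rewrite ler_wpM2r // ler_weXn2l ?ler1n // leq_subr.
  rewrite big_const_nat iter_addr_0 -[_ *+ _]mulr_natl /c -mulrA ler_wpM2r //.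
    by rewrite mulr_ge0 ?exprn_ge0.
  by rewrite ler_nat; lia.
pose Y T : R := (fringe_sum (deep_path k 1) T)%:R.
apply/andP; split.
  rewrite -rrt_meanZr -(rrt_expect_tree _ (fun T => Y T / n.+2%:R)).
  exact: rrt_expect_le.
have -> : n.+2%:R^-1 + rrt_mean n.+1 Y / n.+2%:R + c * z n.+1 =
    rrt_mean n.+1 (fun T => (1 + Y T + c * depth_weight T) / n.+2%:R).
  rewrite rrt_meanZr !rrt_meanD rrt_mean_cst rrt_meanZ !mulrDl mul1r.
  by rewrite mulrA.
rewrite -rrt_expect_tree; exact: rrt_expect_le.
Qed.

(** The partial sums of the limits telescope, and the tail vanishes by
    [path_mean_sum_le]. *)
Lemma cum_rankE k : cum_rank R k.+1 = (\sum_(0 <= i <oo) (path_mean k i)%:E)%E.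
Proof.
pose s k := if k is k'.+1 then limn (series (path_mean k')) else 1.
have rank_limE j : rank_lim R j = s j - s j.+1.
  apply/cvg_lim => //; rewrite (funext (rank_freqE j)).
  apply: cvgB; last exact: rank_tailS_cvg.
  by case: j => [|j]; [exact: rank_tail0_cvg | exact: rank_tailS_cvg].
have s_ge0 j : 0 <= s j.
  case: j => //= j; apply: limr_ge; first exact: path_mean_cvg.
  by apply: nearW => n; apply: sumr_ge0 => i _; exact: path_mean_ge0.
have s_cvg : s @ \oo --> (0 : R).
  rewrite -(cvg_shiftS s).
  apply: (squeeze_cvgr (f := fun=> 0) (h := fun n => n.+1%:R^-1)).
  - apply: nearW => n; rewrite s_ge0 /=.
    apply: limr_le; first exact: path_mean_cvg.
    apply: nearW => m; apply: le_trans (path_mean_sum_le n m) _.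
    by rewrite lef_pV2 ?posrE ?ltr0n // ler_nat.
  - exact: cvg_cst.
  - exact: cvg_harmonic.
transitivity ((s k.+1)%:E).
  apply/cvg_lim => //.
  suff : (fun n => (s k.+1 - s (maxn k.+1 n))%:E) @ \oo --> (s k.+1)%:E.
    apply: cvg_trans; apply: near_eq_cvg; exists k.+1 => // n /= kn.
    have E : \sum_(k.+1 <= i < n) rank_lim R i = s k.+1 - s n.
      rewrite -[RHS]opprB -telescope_sumr // -sumrN.
      by apply: eq_bigr => i _; rewrite opprB rank_limE.
    by rewrite sumEFin E (maxn_idPr kn).
  apply: cvg_EFin; first by apply: nearW.
  rewrite -[X in _ --> X]subr0; apply: cvgB; first exact: cvg_cst.
  apply: cvg_trans s_cvg; apply: near_eq_cvg; exists k.+1 => // n /= kn.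
  by rewrite (maxn_idPr kn).
rewrite /s -EFin_lim; last exact: path_mean_cvg.
by congr (limn _); apply/funext => n; rewrite /= sumEFin.
Qed.

End Limits.

(** * Power series of radius at least one, and the generating functions *)

Section PowerSeries.
Variable R : realType.
Implicit Types (a b c : R^nat) (r x : R).

(** The radius of convergence is at least one. This form is visibly stable under
    formal differentiation. *)
Definition tame c := forall r, 0 < r < 1 -> exists M, forall n, `|c n| * r ^+ n <= M.

Definition psum c (x : R) : R := limn (pseries c x).

(** The left-hand side is at most the sum of the first [n.+1] powers of [r]. *)
Lemma natr_geometric_le r n : 0 < r < 1 -> n.+1%:R * r ^+ n <= (1 - r)^-1.
Proof.
move=> /andP[r0 r1].
apply: (@le_trans _ _ (series (geometric 1 r) n.+1)).
  rewrite /series /= big_mkord mulr_natl -[X in _ *+ X]card_ord -sumr_const.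
  apply: ler_sum => i _; rewrite mul1r ler_wiXn2l ?ltW //.
  by rewrite -ltnS.
by rewrite -[leRHS]mul1r; apply: geometric_le_lim; rewrite // gtr0_norm.
Qed.

Lemma tame_linear c : (forall n, 0 <= c n <= n.+1%:R) -> tame c.
Proof.
move=> cle r r01; exists (1 - r)^-1 => n.
apply: le_trans (natr_geometric_le n r01).
have /andP[c0 cn] := cle n; rewrite ger0_norm // ler_wpM2r // exprn_ge0 //.
by case/andP: r01 => /ltW.
Qed.

Lemma tame_cvg c x : tame c -> `|x| < 1 -> cvgn (pseries c x).
Proof.
move=> tc x1; apply: normed_cvg.
pose r := (`|x| + 1) / 2.
have r01 : 0 < r < 1 by rewrite /r; have := normr_ge0 x; lra.
have [r0 r1] := andP r01; have [M cM] := tc r r01.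
have xr : Num.norm (`|x| / r) < 1.
  by rewrite ger0_norm ?divr_ge0 ?(ltW r0) // ltr_pdivrMr // /r; lra.
apply: (@series_le_cvg _ _ (geometric M (`|x| / r))).
- by move=> n; exact: normr_ge0.
- move=> n; apply: geometric_ge0; last by rewrite divr_ge0 // ltW.
  by apply: le_trans (cM 0%N); rewrite expr0 mulr1.
- move=> n /=; rewrite normrM normrX exprMn exprVn mulrA ler_pdivlMr ?exprn_gt0 //.
  by rewrite mulrAC ler_wpM2r ?exprn_ge0.
- exact: is_cvg_geometric_series.
Qed.

Lemma tame_diffs c : tame c -> tame (pseries_diffs c).
Proof.
move=> tc r /andP[r0 r1].
have [s [s0 s1 rs]] : exists s, [/\ 0 < s, s < 1 & r < s].
  by exists ((r + 1) / 2); split; lra.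
have [M cM] := tc s (introT andP (conj s0 s1)).
have q01 : 0 < r / s < 1 by rewrite divr_gt0 //= ltr_pdivrMr ?mul1r.
exists (M * ((1 - r / s)^-1 / s)) => n.
have -> : `|pseries_diffs c n| * r ^+ n =
    (`|c n.+1| * s ^+ n.+1) * (n.+1%:R * (r / s) ^+ n / s).
  have sn0 : s ^+ n != 0 by rewrite expf_neq0 // gt_eqF.
  have s_neq0 : s != 0 by rewrite gt_eqF.
  rewrite /pseries_diffs normrM normr_nat exprMn exprVn exprS.
  move: (s ^+ n) (r ^+ n) sn0 (n.+1%:R : R) => y z y0 k; field.
  by rewrite s_neq0.
apply: ler_pM.
- by rewrite mulr_ge0 // exprn_ge0 // ltW.
- by rewrite divr_ge0 ?mulr_ge0 ?exprn_ge0 ?divr_ge0 // ltW.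
- exact: cM.
- by rewrite ler_wpM2r ?invr_ge0 ?(ltW s0) // natr_geometric_le.
Qed.

Definition primitive_coef c n : R := if n is m.+1 then c m / m.+1%:R else 0.

Lemma primitive_coefK c : pseries_diffs (primitive_coef c) = c.
Proof. by apply/funext => n; rewrite /pseries_diffs /= mulrC divfK // pnatr_eq0. Qed.

Lemma tame_primitive c : tame c -> tame (primitive_coef c).
Proof.
move=> tc r r01; have [M cM] := tc r r01; have /andP[r0 r1] := r01.
exists M => -[|n] /=.
  rewrite normr0 mul0r; apply: le_trans (cM 0%N).
  by rewrite expr0 mulr1.
apply: le_trans (cM n); rewrite normrM exprSr mulrACA -[leRHS]mulr1.
apply: ler_wpM2l; first by rewrite mulr_ge0 // exprn_ge0 // ltW.
rewrite ger0_norm ?invr_ge0 // ler_pdivrMl ?ltr0n // mulr1.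
by rewrite (le_trans (ltW r1)) // ler1n.
Qed.

Lemma psum0 c : psum c 0 = c 0%N.
Proof.
apply/cvg_lim => //; rewrite -(cvg_shiftS (pseries c 0)).
rewrite (_ : (fun n => _) = fun=> c 0%N); first exact: cvg_cst.
apply/funext => n; rewrite /pseries /series /= big_nat_recl // expr0 mulr1.
by rewrite big1 ?addr0 // => i _; rewrite expr0n mulr0.
Qed.

Lemma is_derive_psum c x : tame c -> `|x| < 1 ->
  is_derive x 1 (psum c) (psum (pseries_diffs c) x).
Proof.
move=> tc x1; pose K := (`|x| + 1) / 2.
have K0 : 0 < K by rewrite /K; have := normr_ge0 x; lra.
have K1 : `|K| < 1 by rewrite gtr0_norm // /K; lra.
have xK : `|x| < `|K| by rewrite (gtr0_norm K0) /K; lra.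
by apply: pseries_snd_diffs xK; apply: tame_cvg => //; do ?apply: tame_diffs.
Qed.

Lemma is_derive_primitive c x : tame c -> `|x| < 1 ->
  is_derive x 1 (psum (primitive_coef c)) (psum c x).
Proof.
move=> tc x1; rewrite -{2}(primitive_coefK c).
by apply: is_derive_psum => //; exact: tame_primitive.
Qed.

Lemma psum_ge0 c x : tame c -> (forall n, 0 <= c n) -> 0 <= x < 1 -> 0 <= psum c x.
Proof.
move=> tc c0 /andP[x0 x1]; apply: limr_ge.
  by apply: tame_cvg; rewrite // ger0_norm.
by apply: nearW => n; apply: sumr_ge0 => i _; rewrite mulr_ge0 // exprn_ge0.
Qed.

Lemma psumD a b x : tame a -> tame b -> `|x| < 1 ->
  psum (fun n => a n + b n) x = psum a x + psum b x.
Proof.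
move=> ta tb x1; apply/cvg_lim => //.
rewrite (_ : pseries _ x = pseries a x \+ pseries b x).
  by apply: cvgD; exact: tame_cvg.
by apply/funext => n; rewrite /pseries /series /= -big_split; apply: eq_bigr => i _; rewrite mulrDl.
Qed.

(** The Cauchy product. For nonnegative terms the product of the partial sums of
    order [n] lies between those of the product series of orders [n] and
    [n + n]. *)
Lemma psumM a b c x : 0 <= x < 1 -> tame a -> tame b -> tame c ->
  (forall n, 0 <= a n) -> (forall n, 0 <= b n) ->
  (forall n, c n = \sum_(i < n.+1) a i * b (n - i)%N) ->
  psum c x = psum a x * psum b x.
Proof.
move=> /andP[x0 x1] ta tb tc a0 b0 cE.
have nx : `|x| < 1 by rewrite ger0_norm.
pose A := pseries a x; pose B := pseries b x; pose C := pseries c x.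
have t0 (u : R^nat) i : (forall n, 0 <= u n) -> 0 <= u i * x ^+ i.
  by move=> u0; rewrite mulr_ge0 // exprn_ge0.
have c0 n : 0 <= c n by rewrite cE sumr_ge0 // => i _; rewrite mulr_ge0.
have nd (u : R^nat) : (forall n, 0 <= u n) -> {homo pseries u x : m n / (m <= n)%N >-> m <= n}.
  by move=> u0; apply: nondecreasing_series => i _ _; exact: t0.
(* The product series sums a_i b_j over the triangle i + j < n. *)
have CE n : C n = \sum_(i < n) a i * x ^+ i * B (n - i)%N.
  elim: n => [|n IH]; first by rewrite /C /pseries /series /= big_nil big_ord0.
  have -> : C n.+1 = C n + c n * x ^+ n by rewrite /C /pseries /series /= big_nat_recr.
  have BS m : B m.+1 = B m + b m * x ^+ m by rewrite /B /pseries /series /= big_nat_recr.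
  have -> : \sum_(i < n.+1) a i * x ^+ i * B (n.+1 - i)%N =
     \sum_(i < n.+1) a i * x ^+ i * B (n - i)%N + c n * x ^+ n.
    rewrite cE mulr_suml -big_split; apply: eq_bigr => i _ /=.
    have lin : (i <= n)%N by rewrite -ltnS.
    have xE : x ^+ n = x ^+ i * x ^+ (n - i) by rewrite -exprD subnKC.
    rewrite (subSn lin) BS xE; ring.
  by rewrite big_ord_recr /= subnn {2}/B /pseries /series /= big_nil mulr0 addr0 IH.
have Bge0 n : 0 <= B n by apply: sumr_ge0 => i _; exact: t0.
have cA : A @ \oo --> psum a x by exact: tame_cvg.
have cB : B @ \oo --> psum b x by exact: tame_cvg.
have cAB : A \* B @ \oo --> psum a x * psum b x by exact: cvgM.
apply/eqP; rewrite eq_le; apply/andP; split.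
  rewrite -(cvg_lim _ cAB) //; apply: ler_lim.
  - exact: tame_cvg.
  - exact: cvgP cAB.
  apply: nearW => n; rewrite -/C CE /= /A /pseries /series /= big_mkord mulr_suml.
  apply: ler_sum => i _; rewrite ler_wpM2l ?t0 //.
  by apply: nd => //; exact: leq_subr.
rewrite -(cvg_lim _ cAB) //; apply: limr_le; first exact: cvgP cAB.
apply: nearW => n; apply: (@le_trans _ _ (C (n + n)%N)); last first.
  by apply: nondecreasing_cvgn_le; [exact: nd | exact: tame_cvg].
rewrite CE /= /A {1}/pseries /series /= big_mkord mulr_suml.
rewrite big_split_ord /= ler_wpDr //.
  by apply: sumr_ge0 => i _; rewrite mulr_ge0 ?t0.
apply: ler_sum => i _; rewrite ler_wpM2l ?t0 //.
by apply: nd => //; have := ltn_ord i; lia.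
Qed.

Lemma derive0_const (h : R -> R) x : 0 <= x < 1 ->
  (forall y : R, 0 <= y < 1 -> is_derive y 1 h (0 : R)) -> h x = h 0.
Proof.
move=> /andP[x0 x1] dh.
have [c _] : exists2 c, c \in `[0, x] & h x - h 0 = 0 * (x - 0).
  apply: (@MVT_segment _ _ (fun=> 0)) => //.
    move=> y; rewrite in_itv /= => /andP[/ltW y0 yx]; apply: dh.
    by rewrite y0 (lt_trans yx).
  apply: derivable_within_continuous => y; rewrite in_itv /= => /andP[y0 yx].
  by have [] := dh y; rewrite ?y0 ?(le_lt_trans yx).
by rewrite mul0r => /eqP; rewrite subr_eq0 => /eqP.
Qed.

Lemma integral_derive (F f : R -> R) u v : u < v ->
  (forall y : R, u <= y <= v -> is_derive y 1 F (f y)) ->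
  (forall y : R, u <= y <= v -> derivable f y 1) ->
  (\int[lebesgue_measure]_(y in `[u, v]) (f y)%:E = (F v - F u)%:E)%E.
Proof.
move=> uv dF df.
have cF (y : R) : u <= y <= v -> {for y, continuous F}.
  by move=> /dF dFy; apply/differentiable_continuous/derivable1_diffP; case: dFy.
rewrite (@continuous_FTC2 _ f F) //.
- by apply: derivable_within_continuous => y; rewrite in_itv /=; exact: df.
- split.
  + by move=> y; rewrite in_itv /= => /andP[/ltW uy /ltW yv]; have [] := dF y; rewrite ?uy.
  + by apply: cvg_at_right_filter; apply: cF; rewrite lexx ltW.
  + by apply: cvg_at_left_filter; apply: cF; rewrite lexx ltW.
- move=> y; rewrite in_itv /= => /andP[/ltW uy /ltW yv].
  by rewrite derive1E; apply: derive_val; apply: dF; rewrite uy.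
Qed.

End PowerSeries.

Section GeneratingFunctions.
Variable R : realType.

(** The coefficients are indexed by the number of edges, i.e. these are
    derivatives of the exponential generating functions of recursive trees counted
    by nodes. *)
Definition kids_coef i n : R := rrt_mean n (fun T => (kids_deep i T)%:R).
Definition deep_coef i n : R := rrt_mean n (fun T => (deep i T)%:R).
Definition path_coef j i n : R := rrt_mean n (fun T => (deep_path j i T)%:R).

Lemma mean_natr_bound (phi : rtree -> nat) : (forall T, (phi T <= (edges T).+1)%N) ->
  forall n, 0 <= rrt_mean n (fun T => (phi T)%:R : R) <= n.+1%:R.
Proof.
move=> le n; rewrite rrt_mean_ge0 //= -[leRHS](rrt_mean_cst n).
by apply: rrt_mean_le => T eT; rewrite ler_nat -eT.
Qed.

Lemma kids_coef_bound i n : 0 <= kids_coef i n <= n.+1%:R.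
Proof. by apply: mean_natr_bound => T; case: kids_deep. Qed.

Lemma deep_coef_bound i n : 0 <= deep_coef i n <= n.+1%:R.
Proof. by apply: mean_natr_bound => T; case: deep. Qed.

Lemma path_coef_bound j i n : 0 <= path_coef j i n <= n.+1%:R.
Proof.
apply: mean_natr_bound => T; rewrite /deep_path.
by case: deep; rewrite ?mul1n ?deep_below_edges.
Qed.

Lemma kids_coef_ge0 i n : 0 <= kids_coef i n.
Proof. by case/andP: (kids_coef_bound i n). Qed.
Lemma deep_coef_ge0 i n : 0 <= deep_coef i n.
Proof. by case/andP: (deep_coef_bound i n). Qed.
Lemma path_coef_ge0 j i n : 0 <= path_coef j i n.
Proof. by case/andP: (path_coef_bound j i n). Qed.

Lemma tame_kids i : tame (kids_coef i).
Proof. exact/tame_linear/kids_coef_bound. Qed.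
Lemma tame_deep i : tame (deep_coef i).
Proof. exact/tame_linear/deep_coef_bound. Qed.
Lemma tame_path j i : tame (path_coef j i).
Proof. exact/tame_linear/path_coef_bound. Qed.

Definition kids_gf i := psum (kids_coef i).
Definition deep_gf i := psum (deep_coef i).
Definition path_gf j i := psum (path_coef j i).
Definition path_int j i := psum (primitive_coef (path_coef j i)).

(** The splitting property at the level of generating functions. *)
Lemma kids_gf_derive i (x : R) : 0 <= x < 1 ->
  is_derive x 1 (kids_gf i) (deep_gf i x * kids_gf i x).
Proof.
move=> x01; have nx : `|x| < 1 by case/andP: x01 => x0 x1; rewrite ger0_norm.
have := is_derive_psum (tame_kids i) nx.
rewrite (psumM x01 (tame_deep i) (tame_kids i)) //.
- exact/tame_diffs/tame_kids.
- exact: deep_coef_ge0.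
- exact: kids_coef_ge0.
move=> n; apply: rrt_mean_splitM => a b.
by rewrite kids_deepG -mulnb natrM.
Qed.

Lemma path_gf_derive j i (x : R) : 0 <= x < 1 ->
  is_derive x 1 (path_gf j.+1 i.+1)
    (path_gf j i.+2 x * kids_gf i x + deep_gf i x * path_gf j.+1 i.+1 x).
Proof.
move=> x01; have nx : `|x| < 1 by case/andP: x01 => x0 x1; rewrite ger0_norm.
pose a n := \sum_(l < n.+1) path_coef j i.+2 l * kids_coef i (n - l)%N.
pose b n := \sum_(l < n.+1) deep_coef i l * path_coef j.+1 i.+1 (n - l)%N.
have a0 n : 0 <= a n.
  by apply: sumr_ge0 => l _; rewrite mulr_ge0 ?path_coef_ge0 ?kids_coef_ge0.
have b0 n : 0 <= b n.
  by apply: sumr_ge0 => l _; rewrite mulr_ge0 ?path_coef_ge0 ?deep_coef_ge0.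
have abE n : pseries_diffs (path_coef j.+1 i.+1) n = a n + b n.
  pose u T : R := if T is Graft s t then (deep_path j i.+2 s)%:R * (kids_deep i t)%:R else 0.
  pose v T : R := if T is Graft s t then (deep i s)%:R * (deep_path j.+1 i.+1 t)%:R else 0.
  rewrite /a -(@rrt_mean_splitM _ n u) // /b -(@rrt_mean_splitM _ n v) // -mulrDr.
  rewrite -rrt_meanD /pseries_diffs; congr (_ * _); apply: eq_rrt_mean => -[|s t] _.
    by rewrite /deep_path /= muln0 addr0.
  by rewrite deep_pathG natrD; congr (_ + _); rewrite [LHS]natrM.
have tame_le (c d : R^nat) : tame d -> (forall n, 0 <= c n <= d n) -> tame c.
  move=> td cd r r01; have [M dM] := td r r01; exists M => n.
  apply: le_trans (dM n); have /andP[c0 cn] := cd n.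
  rewrite ler_wpM2r ?exprn_ge0 ?ger0_norm //; first by case/andP: r01 => /ltW.
  exact: le_trans c0 cn.
have tab := tame_diffs (tame_path j.+1 i.+1).
have ta : tame a by apply: tame_le tab _ => n; rewrite a0 abE lerDl b0.
have tb : tame b by apply: tame_le tab _ => n; rewrite b0 abE lerDr a0.
have := is_derive_psum (tame_path j.+1 i.+1) nx.
rewrite (funext abE) psumD // (psumM x01 (tame_path j i.+2) (tame_kids i) ta) //.
- rewrite (psumM x01 (tame_deep i) (tame_path j.+1 i.+1) tb) //.
  + exact: deep_coef_ge0.
  + exact: path_coef_ge0.
- exact: path_coef_ge0.
- exact: kids_coef_ge0.
Qed.

Definition deep_int i := psum (primitive_coef (deep_coef i)).

Lemma is_derive_expN (p : R -> R) (x dp : R) : is_derive x 1 p dp ->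
  is_derive x 1 (fun y => expR (- p y)) (- dp * expR (- p x)).
Proof.
move=> dpx; have := @is_derive1_comp _ expR (fun y => - p y) x _ _ _ (is_deriveN dpx).
by move=> /(_ (expR (- p x)) (is_derive_expR _)); rewrite mulrC.
Qed.

(** The linear equation of [kids_gf_derive] is solved with the integrating
    factor [expR (- deep_int i)]. *)
Lemma kids_gfE i x : 0 <= x < 1 -> kids_gf i x = expR (deep_int i x).
Proof.
(* The quotient of both sides is constant. *)
move=> x01; pose h y := kids_gf i y * expR (- deep_int i y).
have : h x = h 0.
  apply: derive0_const => // y y01.
  have ny : `|y| < 1 by case/andP: y01 => y0 y1; rewrite ger0_norm.
  have d1 := kids_gf_derive i y01.
  have d2 := is_derive_expN (is_derive_primitive (tame_deep i) ny).
  apply: is_derive_eq (is_deriveM d1 d2) _.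
  by rewrite /GRing.scale /= -/(deep_int i y) -/(deep_gf i y); ring.
rewrite /h /kids_gf /deep_int !psum0 /= oppr0 expR0 /kids_coef rrt_mean0 mulr1 expRN.
move=> /(congr1 (fun z => z * expR (deep_int i x))).
by rewrite mulfVK ?gt_eqF ?expR_gt0 // mul1r.
Qed.

(** By variation of constants, [kids_gf i] being the solution of the homogeneous
    equation. *)
Lemma path_gfE j i x : 0 <= x < 1 ->
  path_gf j.+1 i.+1 x = kids_gf i x * path_int j i.+2 x.
Proof.
(* The difference of both sides divided by kids_gf is constant. *)
move=> x01; pose h y := path_gf j.+1 i.+1 y * expR (- deep_int i y) - path_int j i.+2 y.
have : h x = h 0.
  apply: derive0_const => // y y01.
  have ny : `|y| < 1 by case/andP: y01 => y0 y1; rewrite ger0_norm.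
  have d1 := path_gf_derive j i y01.
  have d2 := is_derive_expN (is_derive_primitive (tame_deep i) ny).
  have d3 := is_derive_primitive (tame_path j i.+2) ny.
  apply: is_derive_eq (is_deriveB (is_deriveM d1 d2) d3) _.
  rewrite /GRing.scale /= -/(deep_int i y) -/(deep_gf i y) -/(path_gf j i.+2 y).
  have : kids_gf i y * expR (- deep_int i y) = 1.
    by rewrite kids_gfE // -expRD subrr expR0.
  move: (expR _) => e ge; set P := path_gf j i.+2 y.
  rewrite -[RHS](subrr P) -{3}[P]mulr1 -ge; ring.
rewrite /h {2}/path_gf {2}/path_int !psum0 /= /path_coef rrt_mean0 /deep_path /=.
rewrite muln0 mul0r subr0 => /eqP; rewrite subr_eq0 => /eqP <-.
by rewrite kids_gfE // mulrC expRN divfK // gt_eqF // expR_gt0.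
Qed.

Lemma deep_gfS i x : 0 <= x < 1 -> deep_gf i.+1 x = kids_gf i x - 1.
Proof.
move=> /andP[x0 x1]; have nx : `|x| < 1 by rewrite ger0_norm.
apply/eqP; rewrite eq_sym subr_eq; apply/eqP.
pose d n : R := (n == 0)%N%:R.
have td : tame d by apply: tame_linear => -[|n]; rewrite /d /= ?ler01 ?lexx ?ler0n.
have -> : 1 = psum d x.
  apply/esym/cvg_lim => //; rewrite -(cvg_shiftS (pseries d x)).
  rewrite (_ : (fun n => _) = fun=> 1); first exact: cvg_cst.
  apply/funext => n; rewrite /pseries /series /= big_nat_recl // expr0 mulr1.
  by rewrite big1 ?addr0 // => l _; rewrite mul0r.
rewrite -psumD //; last exact: tame_deep.
congr (psum _ x); apply/funext => -[|n].
  by rewrite /kids_coef /deep_coef /d !rrt_mean0 add0r.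
rewrite addr0; apply: eq_rrt_mean => -[|a b] //.
Qed.

Lemma integral_deep_gf i x : 0 <= x < 1 ->
  \int[lebesgue_measure]_(y in `[0, x]) deep_gf i y = deep_int i x.
Proof.
move=> /andP[x0 x1]; have [->|xn0] := eqVneq x 0.
  by rewrite set_itv1 Rintegral_set1 /deep_int psum0.
have ny y : 0 <= y <= x -> `|y| < 1.
  by move=> /andP[y0 yx]; rewrite ger0_norm // (le_lt_trans yx).
have x_gt0 : 0 < x by rewrite lt_neqAle eq_sym xn0.
rewrite /Rintegral; suff -> : (\int[lebesgue_measure]_(y in `[0%R, x]) (deep_gf i y)%:E =
    (deep_int i x - deep_int i 0)%:E)%E by rewrite /deep_int [X in _ - X]psum0 subr0.
apply: integral_derive => // y /ny y1.
  by apply: is_derive_primitive => //; exact: tame_deep.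
by have [] := is_derive_psum (tame_deep i) y1.
Qed.

(** The functions of the statement generate the probabilities that the childless
    nodes of a random recursive tree are all at depth at least [i]. *)
Lemma rrt_fE i x : 0 <= x < 1 -> rrt_f i x = deep_gf i x.
Proof.
elim: i x => [|i IH] x x01.
  have /andP[x0 x1] := x01.
  apply/esym/cvg_lim => //; rewrite /= -[X in _ --> X]mul1r.
  rewrite (_ : pseries _ x = series (geometric 1 x)).
    by apply: cvg_geometric_series; rewrite ger0_norm.
  have d1 n : deep_coef 0 n = 1 by rewrite /deep_coef /= rrt_mean_cst.
  rewrite /pseries (_ : (fun i => _) = geometric 1 x) //.
  by apply/funext => n /=; rewrite d1.
rewrite deep_gfS // kids_gfE //= -integral_deep_gf //; congr (expR _ - _).
apply: eq_Rintegral => y; rewrite inE /= in_itv /= => /andP[y0 yx]; apply: IH.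
by case/andP: x01 => _ x1; rewrite y0 (le_lt_trans yx).
Qed.

End GeneratingFunctions.

(** * Integrals of reflected power series *)

Section Reflection.
Variable R : realType.

Lemma is_derive_reflect (f : R -> R) (x df : R) :
  is_derive (1 - x) 1 f df -> is_derive x 1 (fun y => f (1 - y)) (- df).
Proof.
move=> dfx; have d1 : is_derive x 1 (fun y : R => 1 - y) (-1 : R).
  by have := is_deriveB (is_derive_cst (1 : R) x 1) (is_derive_id x 1); rewrite sub0r.
by have := @is_derive1_comp _ f (fun y => 1 - y) x _ _ dfx d1; rewrite mulrN1.
Qed.

Variable c : R^nat.
Hypotheses (tc : tame c) (c0 : forall n, 0 <= c n).

Lemma integral_psum_reflect (b : R) : 0 < b < 1 ->
  (\int[lebesgue_measure]_(y in `]b, 1%R[) (psum c (1 - y))%:E =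
   (psum (primitive_coef c) (1 - b))%:E)%E.
Proof.
move=> /andP[b0 b1].
have ny y : b <= y <= 1 -> `|1 - y| < 1.
  by move=> /andP[bY y1]; rewrite ger0_norm; lra.
have dc (y : R) : b <= y <= 1 -> derivable (fun y : R => psum c (1 - y)) y 1.
  by move=> /ny y1; have [] := is_derive_reflect (is_derive_psum tc y1).
have mc (i : interval R) : {subset i <= `[b, 1]} ->
    measurable_fun [set` i] (fun y : R => psum c (1 - y)).
  move=> ib.
  apply: subspace_continuous_measurable_fun.
    exact: measurable_itv.
  by apply: derivable_within_continuous => y /ib; rewrite in_itv /=; exact: dc.
rewrite integral_itv_bndo_bndc; last first.
  by apply/measurable_EFinP; apply: mc => y; rewrite !in_itv /= => /andP[/ltW -> /ltW ->].
rewrite integral_itv_obnd_cbnd; last first.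
  by apply/measurable_EFinP; apply: mc => y; rewrite !in_itv /= => /andP[/ltW -> ->].
have -> : psum (primitive_coef c) (1 - b) =
    - psum (primitive_coef c) (1 - 1) - - psum (primitive_coef c) (1 - b).
  by rewrite subrr psum0 oppr0 sub0r opprK.
apply: (@integral_derive _ (fun y => - psum (primitive_coef c) (1 - y))) => // y /[dup] yb /ny y1.
rewrite -[X in is_derive _ _ _ X]opprK.
exact: is_deriveN (is_derive_reflect (is_derive_primitive tc y1)).
Qed.

(** The truncation makes the function measurable on the whole line; outside the
    disc of convergence [psum] is a default value. *)
Definition reflected (x : R) : R := if 0 < x < 1 then psum c (1 - x) else 0.

Lemma reflected_ge0 x : 0 <= reflected x.
Proof.
by rewrite /reflected; case: ifP => // /andP[x0 x1]; apply: psum_ge0 => //; lra.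
Qed.

Lemma measurable_reflected : measurable_fun setT reflected.
Proof.
rewrite (_ : reflected = (fun y => psum c (1 - y)) \_ `]0, 1[); last first.
  by apply/funext => x; rewrite /reflected patchE mem_setE in_itv.
apply/(measurable_restrictT _ (measurable_itv _)).
apply: subspace_continuous_measurable_fun.
  exact: measurable_itv.
apply: derivable_within_continuous => y; rewrite in_itv /= => /andP[y0 y1].
have ny : `|1 - y| < 1 by rewrite ger0_norm; lra.
by have [] := is_derive_reflect (is_derive_psum tc ny).
Qed.

(** An instance of the Beta integral, by [x = 1 - (1 - x)]. *)
Lemma integral_beta n :
  (\int[lebesgue_measure]_(x in `]0%R, 1%R[) (x * (1 - x) ^+ n)%:E =
   ((n.+1%:R * n.+2%:R)^-1)%:E :> \bar R)%E.
Proof.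
pose h m (y : R) : R := m.+1%:R^-1 * y ^+ m.+1.
have dX m (z : R) : is_derive z 1 (fun y : R => y ^+ m) (m%:R * z ^+ m.-1).
  have := is_deriveX m (is_derive_id z (1 : R)).
  rewrite /GRing.scale /= mulr1 (_ : id ^+ m = fun y : R => y ^+ m) //.
  by apply/funext => y; elim: m => // m IH; rewrite !exprS -IH.
have dhX m (z : R) : is_derive z 1 (h m) (z ^+ m).
  have := is_deriveZ m.+1%:R^-1 (dX m.+1 z).
  by rewrite /GRing.scale /= mulKf ?pnatr_eq0.
have dh m (y : R) : is_derive y 1 (fun z => h m (1 - z)) (- (1 - y) ^+ m).
  exact: is_derive_reflect.
have xE (y : R) : y * (1 - y) ^+ n = - (1 - y) ^+ n.+1 - - (1 - y) ^+ n.
  by rewrite exprS; ring.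
pose F y := h n.+1 (1 - y) - h n (1 - y).
have dF (y : R) : is_derive y 1 F (y * (1 - y) ^+ n).
  by rewrite xE; exact: is_deriveB.
have df (y : R) : derivable (fun z : R => z * (1 - z) ^+ n) y 1.
  rewrite (funext xE).
  have d m := is_deriveN (is_derive_reflect (dX m (1 - y))).
  by have [] := is_deriveB (d n.+1) (d n).
have mf (i : interval R) : measurable_fun [set` i] (fun y : R => y * (1 - y) ^+ n).
  apply: subspace_continuous_measurable_fun.
    exact: measurable_itv.
  exact: derivable_within_continuous.
rewrite integral_itv_bndo_bndc; last exact/measurable_EFinP.
rewrite integral_itv_obnd_cbnd; last exact/measurable_EFinP.
rewrite (_ : (_ * _)^-1 = F 1 - F 0); first exact: integral_derive.
rewrite /F /h subrr subr0 !expr0n /= !expr1n -!natr1; field.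
by rewrite !natr1 !pnatr_eq0.
Qed.

End Reflection.

(** * The simplex integral *)

(** Tonelli's theorem for the first coordinate. *)
Lemma integral_lebesgue_cons (R : realType) n
    (mu : {sigma_finite_measure set (n.-tuple (measurableTypeR R)) -> \bar R})
    (h : n.+1.-tuple (measurableTypeR R) -> \bar R) :
  measurable_fun setT h -> (forall t, 0 <= h t)%E ->
  (\int[lebesgue_cons mu]_t h t =
   \int[lebesgue_measure]_x \int[mu]_s h (cons_pair (x, s)))%E.
Proof.
move=> mh h0.
transitivity (\int[pushforward (lebesgue_measure \x mu)%E (@cons_pair R n)]_t h t)%E.
  apply: eq_measure_integral; first exact: measurable_cons_pair.
  by [].
rewrite ge0_integral_pushforward //=; last exact: measurable_cons_pair.
rewrite preimage_setT fubini_tonelli1 //.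
by apply: measurableT_comp => //; exact: measurable_cons_pair.
Qed.

Section SimplexIntegral.
Variable R : realType.
Notation Rt n := (n.-tuple (measurableTypeR R)).

(** The integrand of the statement without its first factor, extended by zero
    outside the simplex above [b]. The entries of [t] are the labels, divided by the
    size of the tree, of successive ancestors and of the node itself, oldest first;
    the recursion peels off the oldest ancestor. *)
Fixpoint path_density (j i : nat) (b : R) (t : seq R) : R :=
  if b < t`_0 then
    if j is j'.+1 then
      reflected (@kids_coef R i.-1) t`_0 * path_density j' i.+1 t`_0 (behead t)
    else reflected (@deep_coef R i) t`_0
  else 0.

Lemma path_density_ge0 j i b t : 0 <= path_density j i b t.
Proof.
elim: j i b t => [|j IH] i b t /=; case: ifP => // _.
  by apply: reflected_ge0; [exact: tame_deep | exact: deep_coef_ge0].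
rewrite mulr_ge0 ?IH //.
by apply: reflected_ge0; [exact: tame_kids | exact: kids_coef_ge0].
Qed.

Lemma measurable_path_density j i :
  measurable_fun [set: measurableTypeR R * Rt j.+1]
    (fun p => path_density j i p.1 (p.2 : seq R)).
Proof.
have mhd n : measurable_fun [set: measurableTypeR R * Rt n.+1]
    (fun p => (p.2 : seq R)`_0).
  rewrite (_ : (fun p => _) = (fun t : Rt n.+1 => tnth t ord0) \o snd); last first.
    by apply/funext => -[x t] /=; rewrite (tnth_nth 0).
  by apply: measurableT_comp; [exact: measurable_tnth | exact: measurable_snd].
have mif n : measurable_fun [set: measurableTypeR R * Rt n.+1]
    (fun p => p.1 < (p.2 : seq R)`_0).
  by apply: measurable_fun_ltr; [exact: measurable_fst | exact: mhd].
elim: j i => [|j IH] i /=.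
  apply: measurable_fun_ifT => //; first exact: mif.
  exact: (measurableT_comp (measurable_reflected (@tame_deep R i)) (mhd _)).
apply: measurable_fun_ifT => //; first exact: mif.
apply: measurable_funM.
  exact: (measurableT_comp (measurable_reflected (@tame_kids R i.-1)) (mhd _)).
have mg : measurable_fun [set: measurableTypeR R * Rt j.+2]
    (fun p => ((p.2 : seq R)`_0, [tuple of behead p.2]) : measurableTypeR R * Rt j.+1).
  apply: measurable_fun_pair; first exact: mhd.
  exact: (measurableT_comp (@measurable_behead _ (measurableTypeR R) j.+1) measurable_snd).
exact: measurableT_comp (IH i.+1) mg.
Qed.

(** Integrating out all the coordinates but the first replaces [path_density] by
    [path_gf]: the inner integral is [path_int], by induction with a constant
    [phi], and [path_gfE] multiplies it by the weight of the first coordinate. *)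
Lemma integral_path_density j i (phi : R -> R) b : (0 < i)%N -> 0 <= b ->
  measurable_fun setT phi -> (forall x, 0 < x < 1 -> 0 <= phi x) ->
  (\int[lebesgue_tuple R j.+1]_t
     (phi (t : seq R)`_0 * path_density j i b (t : seq R))%:E =
   \int[lebesgue_measure]_(x in `]b, 1%R[) (phi x * path_gf j i (1 - x))%:E)%E.
Proof.
move=> i0 b0 mphi phi0.
have reflected0 (c : R^nat) x : ~~ (0 < x < 1) -> reflected c x = 0 by rewrite /reflected => /negbTE ->.
have pd0 k l a (t : seq R) : ~~ (0 < t`_0 < 1) -> path_density k l a t = 0.
  by case: k => [|k] tn /=; case: ifP => // _; rewrite reflected0 // mul0r.
have meas k l a (psi : R -> R) : measurable_fun setT psi ->
    measurable_fun [set: Rt k.+1]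
      (fun t => (psi (t : seq R)`_0 * path_density k l a (t : seq R))%:E).
  move=> mpsi; apply/measurable_EFinP; apply: measurable_funM.
    rewrite (_ : (fun t => _) = psi \o (fun t : Rt k.+1 => tnth t ord0)).
      by apply: measurableT_comp => //; exact: measurable_tnth.
    by apply/funext => t /=; rewrite (tnth_nth 0).
  have mpair : measurable_fun [set: Rt k.+1]
      (fun t => (a, t) : measurableTypeR R * Rt k.+1).
    by apply: measurable_fun_pair => //; exact: measurable_cst.
  exact: (measurableT_comp (@measurable_path_density k l) mpair).
have pos k l a (psi : R -> R) (t : Rt k.+1) : (forall x, 0 < x < 1 -> 0 <= psi x) ->
    (0 <= (psi (t : seq R)`_0 * path_density k l a (t : seq R))%:E)%E.
  move=> psi0; rewrite lee_fin; have [t01|tn] := boolP (0 < (t : seq R)`_0 < 1).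
    by rewrite mulr_ge0 ?psi0 ?path_density_ge0.
  by rewrite pd0 // mulr0.
have cons n l a (psi : R -> R) : measurable_fun setT psi ->
    (forall x, 0 < x < 1 -> 0 <= psi x) ->
    (\int[lebesgue_tuple R n.+1]_t
       (psi (t : seq R)`_0 * path_density n l a (t : seq R))%:E =
     \int[lebesgue_measure]_x \int[lebesgue_tuple R n]_s
       (psi x * path_density n l a (x :: (s : seq R)))%:E)%E.
  move=> mpsi psi0; have := @integral_lebesgue_cons R n (lebesgue_tuple R n) _
    (@meas n l a psi mpsi) (fun t => @pos n l a psi t psi0).
  exact.
elim: j i b phi i0 b0 mphi phi0 => [|j IH] i b phi i0 b0 mphi phi0.
  rewrite cons // [RHS]integral_mkcond; apply: eq_integral => x _.
  rewrite patchE mem_setE in_itv /=.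
  rewrite integral_dirac // diracT mul1e.
  case: (ltP b x) => bx /=; last by rewrite mulr0.
  case: (ltP x 1) => x1; last by rewrite reflected0 ?mulr0 // negb_and -!leNgt x1 orbT.
  rewrite /reflected x1 (le_lt_trans b0 bx) /path_gf; congr (_ * psum _ _)%:E.
  by apply/funext => n; apply: eq_rrt_mean => T _; rewrite /deep_path deep_below0 muln1.
rewrite cons // [RHS]integral_mkcond; apply: eq_integral => x _.
rewrite patchE mem_setE in_itv /=.
case: (ltP b x) => bx /=; last first.
  by apply: integral0_eq => s _; rewrite mulr0.
have x0 : 0 < x := le_lt_trans b0 bx.
case: (ltP x 1) => x1; last first.
  by apply: integral0_eq => s _; rewrite reflected0 ?mul0r ?mulr0 // negb_and -!leNgt x1 orbT.
have -> : path_gf j.+1 i (1 - x) = kids_gf i.-1 (1 - x) * path_int j i.+1 (1 - x).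
  by case: i i0 => // i _; rewrite path_gfE //; lra.
rewrite /reflected x0 x1 /=.
have E : (\int[lebesgue_tuple R j.+1]_s (1 * path_density j i.+1 x s)%:E =
    (path_int j i.+1 (1 - x))%:E)%E.
  rewrite (IH i.+1 x (fun=> 1)) //; last exact: ltW.
  under eq_integral do rewrite mul1r.
  by apply: integral_psum_reflect; [exact: tame_path | rewrite x0].
under eq_integral do rewrite mulrA EFinM.
rewrite ge0_integralZl_EFin //.
- rewrite mulrA [RHS]EFinM -E; congr (_ * _)%E.
  by apply: eq_integral => s _; rewrite mul1r.
- by move=> s _; have := pos j i.+1 x (fun=> 1) s; rewrite mul1r; apply.
- have := meas j i.+1 x (fun=> 1) (measurable_cst _).
  by under eq_fun do rewrite mul1r.
by rewrite mulr_ge0 ?phi0 ?x0 // psum_ge0 //; [exact: tame_kids|exact: kids_coef_ge0|lra].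
Qed.

Lemma path_density_simplex j i b (t : seq R) : size t = j.+1 -> (0 < i)%N -> 0 <= b ->
  path_density j i b t =
  if path (fun x y : R => x < y) b (rcons t 1) then
    \prod_(i <= l < i + j) (1 + rrt_f l (1 - t`_(l - i))) * rrt_f (i + j) (1 - t`_j)
  else 0.
Proof.
have lt1 x s : path (fun x y : R => x < y) x (rcons s 1) -> x < 1.
  move=> /(order_path_min lt_trans) /allP; apply.
  by rewrite mem_rcons inE eqxx.
elim: j i b t => [|j IH] i b [//|x s] [sz] i0 b0.
  rewrite (size0nil sz) /= andbT; case: (ltP b x) => bx //=.
  have x0 := le_lt_trans b0 bx.
  rewrite /reflected x0 /=; case: ifP => // x1.
  by rewrite addn0 big_geq // mul1r rrt_fE // /deep_gf; lra.
rewrite [LHS]/= [path _ _ _]/=; case: (ltP b x) => bx //=.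
have x0 := le_lt_trans b0 bx.
rewrite IH ?(ltW x0) //; case: ifP => xs; last by rewrite mulr0.
have x1 := lt1 _ _ xs; rewrite /reflected x0 x1 mulrA addSnnS; congr (_ * _).
rewrite [RHS]big_ltn ?addnS ?ltnS ?leq_addr // subnn /=; congr (_ * _).
  case: i i0 => // i _; rewrite rrt_fE ?deep_gfS //=; try lra.
  by rewrite addrCA subrr addr0.
by apply: eq_big_nat => l /andP[il _]; rewrite -(subnSK il).
Qed.

(** Term by term, the integral of [x * (1 - x) ^+ n] is the frequency
    [1 / (n.+1 * n.+2)] of fringe subtrees with [n.+1] nodes. *)
Lemma integral_path_gf k :
  (\int[lebesgue_measure]_(x in `]0%R, 1%R[) (x * @path_gf R k 1 (1 - x))%:E =
   \sum_(0 <= n <oo) (@path_mean R k n)%:E)%E.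
Proof.
pose f n (x : R) := x * (1 - x) ^+ n.
have f0 n x : `]0%R, 1%R[%classic x -> 0 <= f n x.
  by rewrite /= in_itv /= => /andP[x0 x1]; rewrite mulr_ge0 ?exprn_ge0 //; lra.
have mf n : measurable_fun [set` `](0 : R), (1 : R)[] (f n).
  apply: measurable_funTS; apply: measurable_funM => //.
  apply: measurable_funX; apply: measurable_funB => //; exact: measurable_cst.
transitivity (\int[lebesgue_measure]_(x in `]0%R, 1%R[)
    \sum_(0 <= n <oo) (path_coef R k 1 n * f n x)%:E)%E.
  apply: eq_integral => x; rewrite inE /= in_itv /= => /andP[x0 x1].
  have nx : `|1 - x| < 1 by rewrite ger0_norm; lra.
  apply/esym/cvg_lim => //.
  apply: cvg_EFin; first by apply: nearW => n; rewrite sumEFin.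
  rewrite (_ : fine \o _ = fun n => x * pseries (path_coef R k 1) (1 - x) n).
    by apply: cvgMr; exact: tame_cvg (@tame_path R k 1) nx.
  apply/funext => n; rewrite /= sumEFin /= /pseries /series /= mulr_sumr.
  by apply: eq_bigr => l _; rewrite /f mulrCA.
rewrite integral_nneseries //.
- apply: eq_eseriesr => n _.
  under eq_integral do rewrite EFinM.
  rewrite ge0_integralZl_EFin ?path_coef_ge0 //.
  + by rewrite integral_beta.
  + by move=> x x01; rewrite lee_fin f0.
  + by apply/measurable_EFinP; exact: mf.
- by move=> n; apply/measurable_EFinP; apply: measurable_funM; [exact: measurable_cst|exact: mf].
- by move=> n x x01; rewrite lee_fin mulr_ge0 ?path_coef_ge0 ?f0.
Qed.

End SimplexIntegral.

Theorem theorem1 (R : realType) (k : nat) (hk : (1 <= k)%N) :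
  cum_rank R k =
  (\int[lebesgue_tuple R k]_(a in @open_simplex R k)
    ((a : seq R)`_0 * rrt_f k (1 - (a : seq R)`_k.-1) *
     \prod_(1 <= i < k) (1 + rrt_f i (1 - (a : seq R)`_i.-1)))%:E)%E.
Proof.
case: k hk => // k _.
rewrite cum_rankE -integral_path_gf.
rewrite -(@integral_path_density R k 1 id 0) //; last by move=> x /andP[/ltW].
rewrite [RHS]integral_mkcond; apply: eq_integral => a _.
rewrite patchE mem_setE path_density_simplex ?size_tuple //.
rewrite unfold_in; case: ifP => // _; last by rewrite mulr0.
congr (_%:E); rewrite [LHS]mulrCA [LHS]mulrC add1n; congr (_ * _).
by apply: eq_big_nat => i _; rewrite subn1.
Qed.
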